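(* Let $p$ be a prime, let $n \geq 2$ be an integer, let $q = p^s$ and $r = q^t$ with integers $s, t \geq 1$, and assume \[ r \geq \frac{3n + 2 + \sqrt{9n^2 + 4n + 4}}{2}. \] If $q \geq 4$, then there exist algebraic Laurent series $\alpha \in \mathbb{F}_q((T^{-1}))$ with $\deg \alpha = r+1$ such that $w_n(\alpha) \neq w_n^{*}(\alpha)$.
   Context: $\mathbb{F}_q((T^{-1}))$ is the field of Laurent series $\xi=\sum_{m\ge N} a_m T^{-m}$ ($a_m\in\mathbb{F}_q$) with the absolute value $|\xi| = q^{-N}$ when $a_N \neq 0$, and $|0|=0$; this absolute value is extended uniquely to an algebraic closure of $\mathbb{F}_q((T^{-1}))$. The height $H(P)$ of $P \in (\mathbb{F}_q[T])[X]$ is the maximum of the absolute values of its coefficients. For $\alpha$ algebraic over $\mathbb{F}_q(T)$, its minimal polynomial is the unique non-constant, irreducible, primitive polynomial $P\in(\mathbb{F}_q[T])[X]$ whose leading coefficient is monic in $T$ and with $P(\alpha)=0$; $H(\alpha):=H(P)$ and $\deg\alpha:=\deg P$. For an integer $n\ge1$ and $\xi \in \mathbb{F}_q((T^{-1}))$, $w_n(\xi)$ is the supremum of real $w$ such that $0<|P(\xi)|\le H(P)^{-w}$ for infinitely many $P\in(\mathbb{F}_q[T])[X]$ of degree at most $n$, and $w_n^*(\xi)$ is the supremum of real $w^*$ such that $0<|\xi-\alpha|\le H(\alpha)^{-w^*-1}$ for infinitely many $\alpha\in\overline{\mathbb{F}_q(T)}$ of degree at most $n$. *)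

(* Defs.v *)
From HB Require Import structures.
From mathcomp Require Import all_boot all_order all_algebra.
From mathcomp Require Import boolp classical_sets cardinality reals ereal exp.
Set Implicit Arguments. Unset Strict Implicit. Unset Printing Implicit Defensive.
Import Order.TTheory GRing.Theory Num.Theory.
Local Open Scope ring_scope.

(* Laurent series  xi = sum_{m >= N} a_m T^{-m}  in F((T^{-1})).             *)
(* A representative is a pair (N, c) with  a_{N+k} = c k  for k : nat and    *)
(* a_m = 0 for m < N.  Two representatives denote the same series iff they   *)
(* have the same coefficient function [lcoef].                               *)
Record laurent (F : finFieldType) := Laurent { lstart : int; lseq : nat -> F }.

Section Laurent.
Variable F : finFieldType.
Implicit Types x y : laurent F.

(* coefficient of T^{-m} *)
Definition lcoef x (m : int) : F :=
  if (lstart x <= m)%R then lseq x `|m - lstart x|%N else 0.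

Definition lzero : laurent F := Laurent 0 (fun _ => 0).
Definition lone : laurent F := Laurent 0 (fun k => if k == 0%N then 1 else 0).

Definition ladd x y : laurent F :=
  let N := Num.min (lstart x) (lstart y) in
  Laurent N (fun k => lcoef x (N + k%:Z) + lcoef y (N + k%:Z)).

Definition lmul x y : laurent F :=
  Laurent (lstart x + lstart y)
    (fun k => \sum_(i < k.+1) lseq x i * lseq y (k - i)%N).

Fixpoint lexp x (i : nat) : laurent F :=
  if i is j.+1 then lmul (lexp x j) x else lone.

(* the polynomial a(T) = sum_j a_j T^j, as a Laurent series in T^{-1}:
   coefficient of T^{-(-size a + k)} = T^{size a - k} is a_{size a - k}. *)
Definition lpoly (a : {poly F}) : laurent F :=
  Laurent (- (size a)%:Z) (fun k => if (k <= size a)%N then a`_(size a - k) else 0).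

Definition leval (P : {poly {poly F}}) x : laurent F :=
  \big[ladd/lzero]_(i < size P) lmul (lpoly P`_i) (lexp x i).

Definition lval x : option int :=
  match pselect (exists k : nat, lcoef x (lstart x + k%:Z) != 0) with
  | left h => Some (lstart x + (ex_minn h)%:Z)
  | right _ => None
  end.

Definition labs (R : realType) x : R :=
  match lval x with
  | Some N => (#|F|%:R : R) ^ (- N)
  | None => 0
  end.

Definition pabs (R : realType) (a : {poly F}) : R :=
  if a == 0 then 0 else (#|F|%:R : R) ^+ (size a).-1.

Definition height (R : realType) (P : {poly {poly F}}) : R :=
  \big[Num.max/0]_(i < size P) pabs R P`_i.

Definition degX (P : {poly {poly F}}) : nat := (size P).-1.

Definition irreducibleTX (P : {poly {poly F}}) : Prop :=
  P != 0 /\ ~ (P \is a GRing.unit) /\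
  forall A B : {poly {poly F}}, P = A * B -> A \is a GRing.unit \/ B \is a GRing.unit.

Definition primitiveTX (P : {poly {poly F}}) : Prop :=
  forall d : {poly F}, (forall i, (d %| P`_i)%R) -> (size d <= 1)%N.

Definition minpoly_shape (P : {poly {poly F}}) : Prop :=
  (1 < size P)%N /\ irreducibleTX P /\ primitiveTX P /\ lead_coef P \is monic.

Definition is_minpolyL (P : {poly {poly F}}) x : Prop :=
  minpoly_shape P /\ forall m, lcoef (leval P x) m = 0.

Definition wn (R : realType) (n : nat) x : \bar R :=
  ereal_sup [set w%:E | w in
    [set w : R | infinite_set
       [set P : {poly {poly F}} | (degX P <= n)%N /\
          0 < labs R (leval P x) /\ labs R (leval P x) <= height R P `^ (- w)]]].

(* w_n^*(xi), computed in an algebraically closed field K endowed with an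
   absolute value [absK] and an embedding [iota] of F((T^{-1})) (see the
   hypotheses of the main theorem). *)
Definition evalK (K : closedFieldType) (iota : laurent F -> K)
    (P : {poly {poly F}}) (a : K) : K :=
  \sum_(i < size P) iota (lpoly P`_i) * a ^+ i.

Definition is_minpolyK (K : closedFieldType) (iota : laurent F -> K)
    (P : {poly {poly F}}) (a : K) : Prop :=
  minpoly_shape P /\ evalK iota P a = 0.

Definition wn_star (R : realType) (K : closedFieldType) (absK : K -> R)
    (iota : laurent F -> K) (n : nat) x : \bar R :=
  ereal_sup [set w%:E | w in
    [set w : R | infinite_set
       [set a : K | exists P, is_minpolyK iota P a /\ (degX P <= n)%N /\
          0 < absK (iota x - a) /\
          absK (iota x - a) <= height R P `^ (- w - 1)]]].

Definition valued_closure (R : realType) (K : closedFieldType) (absK : K -> R)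
    (iota : laurent F -> K) : Prop :=
  [/\ (forall a : K, 0 <= absK a),
      (forall a : K, absK a = 0 -> a = 0),
      (forall a b : K, absK (a * b) = absK a * absK b),
      (forall a b : K, absK (a + b) <= Num.max (absK a) (absK b)) &
   [/\ (forall x y, lcoef x =1 lcoef y -> iota x = iota y),
       (forall x y, iota (ladd x y) = iota x + iota y),
       (forall x y, iota (lmul x y) = iota x * iota y),
       iota lone = 1 &
       (forall x, absK (iota x) = labs R x)]].

End Laurent.

(* Main.v *)
Require Import Defs.
From HB Require Import structures.
From mathcomp Require Import all_boot all_order all_algebra finfield.
From mathcomp Require Import boolp classical_sets cardinality reals ereal exp.
From mathcomp Require Import zify ring lra.
Set Implicit Arguments. Unset Strict Implicit. Unset Printing Implicit Defensive.
Import Order.TTheory GRing.Theory Num.Theory.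
Local Open Scope ring_scope.

(* Put r = q^t, A = T + c with X^2 + cX - 1 irreducible over F_q, and let
   (e b; b d) be the l-th power of (0 1; 1 A), a matrix of determinant +-1
   fixing the roots of P_0 = X^2 + AX - 1.  The series alpha is the fixed point
   with |alpha| < 1 of x |-> (e x^r + b) / (b x^r + d); for large l it is very
   close to a root of P_0.  Substituting the inverse matrix into the Frobenius
   twist of P_k gives quadratics P_k with P_(k+1)(alpha) = lam^2 P_k(alpha)^r
   and |lam| = 1 / |d|, so that |P_k(alpha)| = H(P_k)^(-w + o(1)) for some
   w > r - 1, whence w_n(alpha) > r - 1.

   Conversely w_n^*(alpha) <= r - 1.  An algebraic number a whose minimal
   polynomial Q is no multiple of a P_k is kept away from alpha by the nonzero
   resultants of Q with the P_k, and this is where the lower bound on r enters.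
   The two roots of P_k are much closer to each other than the height suggests
   (disc P_k is the r^k-th power of disc P_0), so a root of P_k is farther from
   alpha than the size of P_k(alpha) alone would allow.

   The equation of alpha is irreducible of degree r + 1: one edge of its Newton
   polygon at infinity forces a factor of degree at least r, and a cofactor of
   degree 1 is excluded by setting T = 0. *)

(** * Factorization over F[T] *)

Section Gauss.
Variable F : fieldType.
Implicit Types (c d : {poly F}) (U V Q : {poly {poly F}}).

Lemma irreducible_factor (a : {poly F}) : (1 < size a)%N ->
  exists2 d, irreducible_poly d & d %| a.
Proof.
have [m] := ubnP (size a); elim: m a => // m IH a lam a1.
have [ira | nira] := pselect (irreducible_poly a); first by exists a.
have [q [q1 qa nqa]] : exists q : {poly F}, [/\ size q != 1, q %| a & ~~ (q %= a)].
  apply: contrapT => H; apply: nira; split=> // q q1 qa.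
  by apply: contrapT => /negP nqa; apply: H; exists q.
have a0 : a != 0 by rewrite -size_poly_gt0; lia.
have q0 : q != 0 by apply: contraTneq qa => ->; rewrite dvd0p.
have [||d ird dq] := IH q.
- apply: (@leq_trans (size a)); last by rewrite -ltnS.
  by rewrite ltn_neqAle dvdp_size_eqp // nqa dvdp_leq.
- by move: q1 q0; rewrite -size_poly_gt0; case: (size q) => [|[|]].
by exists d => //; apply: dvdp_trans dq qa.
Qed.

Lemma irreducible_dvdM d a b : irreducible_poly d ->
  d %| a * b -> (d %| a) || (d %| b).
Proof.
move=> ird dab; case: (boolP (d %| a)) => //= nda.
by rewrite -(Gauss_dvdpr _ (_ : coprimep d a)) // irreducible_poly_coprime.
Qed.

Lemma irreducible_dvdX d a m : irreducible_poly d -> d %| a ^+ m -> d %| a.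
Proof.
move=> ird; elim: m => [|m IH].
  by rewrite expr0 dvdp1 => /eqP d1; move: ird.1; rewrite d1.
by rewrite exprS => /(irreducible_dvdM ird)/orP[] // /IH.
Qed.

(** Gauss's lemma. Take the least indices i and j at which d fails to divide a coefficient of U and
    of V: in the coefficient of index i + j of the product, every term except U_i V_j is divisible
    by d. *)
Lemma irreducible_dvd_coefM d U V : irreducible_poly d ->
  (forall i, d %| (U * V)`_i) -> (forall i, d %| U`_i) \/ (forall i, d %| V`_i).
Proof.
move=> ird dUV; apply: contrapT => /not_orP[].
move=> /existsNP[i0 /negP hi0] /existsNP[j0 /negP hj0].
have exi : exists i, ~~ (d %| U`_i) by exists i0.
have exj : exists j, ~~ (d %| V`_j) by exists j0.
case: (ex_minnP exi) => i hi mini; case: (ex_minnP exj) => j hj minj.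
have lti : (i < (i + j).+1)%N by rewrite ltnS leq_addr.
have := dUV (i + j)%N; rewrite coefM (bigD1 (Ordinal lti)) //= addKn.
rewrite dvdp_addl; last first.
  apply: (big_ind (fun p => d %| p)) => [|p q|k /eqP nki]; rewrite ?dvdp0 //.
    exact: dvdp_add.
  have {}nki : (k : nat) != i.
    by apply/eqP => ki; apply: nki; apply: val_inj.
  case: (ltnP k i) => ki.
    apply: dvdp_mulr; apply: contraTT ki => /mini; rewrite -leqNgt //.
  apply: dvdp_mull; apply: contrapT => /negP /minj; have := ltn_ord k; lia.
by move=> /(irreducible_dvdM ird); rewrite (negPf hi) (negPf hj).
Qed.

Lemma dvd_coef_scale d U : (forall i, d %| U`_i) -> exists U', U = d *: U'.
Proof.
move=> dU; exists (\poly_(i < size U) (U`_i %/ d)).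
apply/polyP => i; rewrite coefZ coef_poly; case: ltnP => hi.
  by rewrite mulrC divpK.
by rewrite mulr0 nth_default.
Qed.

(** A factorization over F(T), with denominators cleared by c, descends to F[T]. By Gauss's lemma an
    irreducible factor of c divides all coefficients of U or all those of V; it is cancelled there,
    and the degree of c drops. *)
Lemma gauss_factor c Q U V : c != 0 -> c *: Q = U * V ->
  exists u v U' V', [/\ u != 0, v != 0, U = u *: U', V = v *: V' & Q = U' * V'].
Proof.
have [m] := ubnP (size c); elim: m c U V => // m IH c U V lcm c0 cQ.
have [c1 | c1] := leqP (size c) 1.
  have sc1 : size c == 1%N by rewrite eqn_leq c1 size_poly_gt0.
  have /size_poly1P[k k0 ck] := sc1.
  exists c, 1, (k^-1%:P *: U), V; split; rewrite ?oner_neq0 ?scale1r //.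
    by rewrite scalerA ck -polyCM divff // scale1r.
  by rewrite -scalerAl -cQ scalerA ck -polyCM mulVf // scale1r.
have [d ird dc] := irreducible_factor c1.
have d0 : d != 0 by apply: irredp_neq0.
have dP0 : d%:P != 0 by rewrite polyC_eq0.
have [c' cE] : exists c', c = d * c' by exists (c %/ d); rewrite mulrC divpK.
have c'0 : c' != 0 by apply: contraNneq c0; rewrite cE => ->; rewrite mulr0.
have szc : (size c' < m)%N.
  rewrite -ltnS (leq_trans _ lcm) // ltnS cE size_mul //.
  by have := ird.1; case: (size d) => [|[|k]] // _; rewrite !addSn /= ltnS leq_addl.
have dUV i : d %| (U * V)`_i by rewrite -cQ coefZ dvdp_mulr.
have [/dvd_coef_scale|/dvd_coef_scale] := irreducible_dvd_coefM ird dUV => -[W WE].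
- have [|u [v [U' [V' [u0 v0 WU' VV' QE]]]]] := IH c' W V szc c'0.
    apply: (mulfI dP0); rewrite !mul_polyC.
    by rewrite scalerA -cE cQ WE -scalerAl.
  exists (d * u), v, U', V'; split => //; first by rewrite mulf_neq0.
  by rewrite WE WU' scalerA.
- have [|u [v [U' [V' [u0 v0 WU' VV' QE]]]]] := IH c' U W szc c'0.
    apply: (mulfI dP0); rewrite !mul_polyC.
    by rewrite scalerA -cE cQ WE -scalerAr.
  exists u, (d * v), U', V'; split => //; first by rewrite mulf_neq0.
  by rewrite WE VV' scalerA.
Qed.

End Gauss.

(** The factor V has the root x / y = - V_0 / V_1 in the fraction field, hence so has P; multiplying
    by y^m clears the denominators. *)
Lemma linear_factor_zero (R : idomainType) (c : R) (P U V : {poly R}) :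
  c != 0 -> c *: P = U * V -> size V = 2%N ->
  exists x y, y != 0 /\ forall m, (size P <= m.+1)%N ->
    \sum_(i < m.+1) P`_i * x ^+ i * y ^+ (m - i) = 0.
Proof.
move=> c0 cP sV; exists (- V`_0), V`_1.
pose f : {rmorphism R -> {fraction R}} := @tofrac R.
have f_eq0 a : (f a == 0) = (a == 0) by exact: tofrac_eq0.
have y0 : V`_1 != 0 by rewrite -[1%N]/(2.-1) -sV -lead_coefE lead_coef_eq0 -size_poly_gt0 sV.
split=> // m sP; apply/eqP; rewrite -f_eq0.
set x := - V`_0; set y := V`_1.
have f_inj : injective f by move=> a b /eqP; rewrite tofrac_eq => /eqP.
have fy0 : f y != 0 by rewrite f_eq0.
have Vz : (map_poly f V).[f x / f y] = 0.
  rewrite (@horner_coef_wide _ 2) ?size_map_inj_poly ?sV ?rmorph0 //.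
  rewrite big_ord_recl big_ord1 !coef_map /= expr0 expr1 mulr1 mulrCA divff // mulr1.
  by rewrite -rmorphD /= /x subrr rmorph0.
have Pz : (map_poly f P).[f x / f y] = 0.
  have /eqP : (map_poly f (c *: P)).[f x / f y] = 0.
    by rewrite cP rmorphM hornerM Vz mulr0.
  rewrite linearZ_LR /= hornerZ mulf_eq0 f_eq0 (negPf c0) /=.
  by move/eqP.
have -> : f (\sum_(i < m.+1) P`_i * x ^+ i * y ^+ (m - i)) =
    f y ^+ m * (map_poly f P).[f x / f y].
  rewrite (@horner_coef_wide _ m.+1) ?size_map_inj_poly ?rmorph0 //.
  rewrite rmorph_sum mulr_sumr; apply: eq_bigr => i _.
  rewrite !rmorphM !rmorphXn coef_map /= exprMn exprVn.
  have -> : f y ^+ m = f y ^+ (m - i) * f y ^+ i by rewrite -exprD subnK // -ltnS.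
  by rewrite [RHS]mulrC -[RHS]mulrA (mulrACA (f x ^+ i)) mulVf ?expf_neq0 // mulr1 mulrA.
by rewrite Pz mulr0.
Qed.

(** Infinite descent: both coordinates of a zero vanish at T = 0, so both can be divided by T, and
    homogeneity makes the quotients a smaller zero. *)
Lemma homogeneous_zero (F : fieldType) (m : nat)
    (G : {poly F} -> {poly F} -> {poly F}) :
  (forall a x y, G (a * x) (a * y) = a ^+ m * G x y) ->
  (forall x y, G x y = 0 -> x.[0] = 0 /\ y.[0] = 0) ->
  forall x y, G x y = 0 -> x = 0 /\ y = 0.
Proof.
move=> Gh G0 x y; have [k] := ubnP (size x + size y)%N.
elim: k x y => // k IH x y lk Gxy.
have [x0 y0] := G0 _ _ Gxy.
have div0 (z : {poly F}) : z.[0] = 0 -> exists2 z', z = 'X * z' &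
    (size z' <= (size z).-1)%N.
  move=> /eqP z0; have /factor_theorem[z' zE] : root z 0 by [].
  exists z'; first by rewrite zE subr0 mulrC.
  have [-> | z'0] := eqVneq z' 0; first by rewrite size_poly0.
  by rewrite zE size_mul ?polyXsubC_eq0 // size_XsubC addn2.
have [x' xE sx] := div0 x x0; have [y' yE sy] := div0 y y0.
case: (posnP (size x + size y)) => [/eqP|xy0].
  by rewrite addn_eq0 !size_poly_eq0 => /andP[/eqP -> /eqP ->].
have [||x'0 y'0] := IH x' y'; last by rewrite xE yE x'0 y'0 mulr0.
  by lia.
by move/eqP: Gxy; rewrite xE yE Gh mulf_eq0 expf_eq0 polyX_eq0 andbF /= => /eqP.
Qed.

(** * The Newton polygon at infinity *)

Section Newton.
Variables (F : fieldType) (r : nat).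
Implicit Types U V : {poly {poly F}}.

(* [weigh] substitutes T -> S^r and X -> S Y; the leading coefficient in S,
   a polynomial in Y, picks the terms of U lying on the edge of slope -1/r of
   the Newton polygon at infinity. *)
Definition weigh U : {poly {poly F}} :=
  (map_poly (fun a : {poly F} => map_poly polyC a \Po 'X^r) U).['X%:P * 'X].

Lemma weighM : {morph weigh : U V / U * V}.
Proof.
pose f := (comp_poly ('X^r : {poly {poly F}}) \o map_poly (polyC : F -> {poly F}))%FUN.
by move=> U V; rewrite /weigh (rmorphM (map_poly f)) hornerM.
Qed.

(** The monomial T^m X^j becomes S^(rm + j) Y^j, so the weight w and the exponent j determine m = (w
    - j) / r. *)
Lemma coef_weigh U w j : (0 < r)%N -> ((weigh U)`_w)`_j =
  if (j <= w)%N && (r %| w - j)%N then (U`_j)`_((w - j) %/ r)%N else 0.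
Proof.
move=> r0; pose f := (comp_poly ('X^r : {poly {poly F}}) \o map_poly (polyC : F -> {poly F}))%FUN.
rewrite /weigh -[map_poly _ U]/(map_poly f U).
rewrite (@horner_coef_wide _ (size U + j.+1)); last first.
  by rewrite (leq_trans (size_poly _ _)) // leq_addr.
rewrite coef_sum coef_sum.
have jlt : (j < size U + j.+1)%N by rewrite addnS ltnS leq_addl.
rewrite (bigD1 (Ordinal jlt)) //= [X in _ + X]big1 ?addr0.
  rewrite coef_map /= exprMn mulrA coefMXn ltnNge; case: leqP => //= jw; last by rewrite coef0.
  rewrite -rmorphXn /= coefMC coefMXn ltnn subnn /f /= coef_comp_poly_Xn //.
  by case: ifP => _; rewrite ?coef0 // coef_map coefC eqxx.
move=> i nij; rewrite coef_map /= exprMn mulrA coefMXn; case: ltnP => //= iw; first by rewrite coef0.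
rewrite -rmorphXn /= coefMC coefMXn /f /= coef_comp_poly_Xn //.
case: ltnP => // ij; case: ifP => _; rewrite ?coef0 // coef_map coefC.
case: eqP => // jmi; case/eqP: nij; apply: val_inj => /=; move: ij jmi; lia.
Qed.

Lemma weigh_eq0 U : (0 < r)%N -> (weigh U == 0) = (U == 0).
Proof.
move=> r0; apply/eqP/eqP => [U0|->]; last first.
  by rewrite /weigh map_poly0 horner0.
apply/polyP => j; apply/polyP => k; rewrite coef0 coef0.
have := coef_weigh U (j + k * r) j r0.
by rewrite U0 !coef0 leq_addr addKn dvdn_mull //= mulnK.
Qed.

Lemma lead_weigh_support U i j : (0 < r)%N ->
  (lead_coef (weigh U))`_i != 0 -> (lead_coef (weigh U))`_j != 0 -> i = j %[mod r].
Proof.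
move=> r0; rewrite /lead_coef !coef_weigh //; set w := (_.-1).
case: ifP => [/andP[iw di] _|_]; last by rewrite eqxx.
case: ifP => [/andP[jw dj] _|_]; last by rewrite eqxx.
move: di dj; rewrite -!eqn_mod_dvd // => /eqP di /eqP dj.
by rewrite -di -dj.
Qed.

(** All exponents of Y at a given weight are congruent modulo r, and below r there is only one in
    each class. *)
Lemma lead_weigh_small U : (0 < r)%N -> (size (lead_coef (weigh U)) <= r)%N ->
  exists k c, lead_coef (weigh U) = c *: 'X^k.
Proof.
move=> r0; set L := lead_coef _ => sL; exists (size L).-1, (lead_coef L).
apply/polyP => i; rewrite coefZ coefXn; have [->|ni] := eqVneq i (size L).-1.
  by rewrite mulr1.
rewrite mulr0; apply/eqP/negPn/negP => Li.
have iL : (i < size L)%N by apply: contraR Li; rewrite -leqNgt => ?; rewrite nth_default.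
have Lt : L`_(size L).-1 != 0.
  by rewrite -[X in X != 0]/(lead_coef L) lead_coef_eq0 -size_poly_gt0 (leq_ltn_trans _ iL).
have L0 : (0 < size L)%N by apply: leq_ltn_trans iL.
have := lead_weigh_support r0 Li Lt.
have ir : (i < r)%N by apply: leq_trans sL.
have kr : ((size L).-1 < r)%N by rewrite prednK.
rewrite (modn_small ir) (modn_small kr) => iE.
by rewrite iE eqxx in ni.
Qed.

Lemma lead_weigh_large U : (0 < r)%N -> (r < size (lead_coef (weigh U)))%N ->
  (r < size U)%N.
Proof.
move=> r0; set L := lead_coef _ => sL.
have : L`_(size L).-1 != 0.
  by rewrite -[X in X != 0]/(lead_coef L) lead_coef_eq0 -size_poly_gt0 (leq_ltn_trans _ sL).
rewrite {1}/L /lead_coef coef_weigh //; case: ifP => [_|]; last by rewrite eqxx.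
apply: contraR; rewrite -leqNgt => sU; rewrite [U`_ _]nth_default ?coef0 //.
by rewrite (leq_trans sU) // -ltnS prednK // (leq_ltn_trans _ sL).
Qed.

(** The edge polynomial Y^(r+1) + Y is the product of those of U and V. If both had degree less than
    r in Y, both would be monomials, and so would their product. Hence one factor has degree at
    least r in X, which leaves at most degree 1 for the other. *)
Lemma newton_edge_factor U V : (0 < r)%N ->
  lead_coef (weigh (U * V)) = 'X^(r.+1) + 'X -> (size (U * V)%R <= r.+2)%N ->
  (size U <= 2)%N \/ (size V <= 2)%N.
Proof.
move=> r0; rewrite weighM lead_coefM => LE sUV.
have : U * V != 0.
  apply: contraTneq isT => UV0; move: LE; rewrite -lead_coefM -weighM UV0.
  have /eqP-> : weigh 0 == 0 by rewrite weigh_eq0.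
  rewrite lead_coef0 => /polyP/(_ 1%N); rewrite coefD coefXn coefX coef0 /=.
  by rewrite eqSS (ltn_eqF r0) add0r => /eqP; rewrite eq_sym oner_eq0.
rewrite mulf_eq0 negb_or => /andP[U0 V0].
have {}sUV : ((size U + size V).-1 <= r.+2)%N by rewrite -size_mul.
have [sU | lU] := leqP (size (lead_coef (weigh U))) r; last first.
  have := lead_weigh_large r0 lU; right; move: sUV; lia.
have [sV | lV] := leqP (size (lead_coef (weigh V))) r; last first.
  have := lead_weigh_large r0 lV; left; move: sUV; lia.
have [k [x kx]] := lead_weigh_small r0 sU; have [m [y my]] := lead_weigh_small r0 sV.
exfalso; move: LE; rewrite kx my -scalerAl -scalerAr scalerA -exprD => /polyP LE.
have := LE 1%N; have := LE r.+1.
rewrite !coefZ !coefD !coefXn !coefX !eqxx eqSS !eqSS (ltn_eqF r0) (gtn_eqF r0) /=.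
rewrite addr0 add0r; case: eqP => [<-|_]; last by rewrite mulr0 => /eqP; rewrite eq_sym oner_eq0.
by rewrite eqSS (ltn_eqF r0) mulr0 => _ /eqP; rewrite eq_sym oner_eq0.
Qed.

End Newton.

(** * Continuants and the hyperquadratic equation *)

Fixpoint fib (R : pzRingType) (a : R) (k : nat) : R :=
  match k with
  | 0 => 0
  | 1 => 1
  | (m.+1 as k').+1 => fib a m + fib a k' * a
  end.

Lemma fibSS (R : pzRingType) (a : R) k : fib a k.+2 = fib a k + fib a k.+1 * a.
Proof. by []. Qed.

(** The left side is the determinant of the (k+1)-th power of (0 1; 1 a), a matrix of determinant
    -1. *)
Lemma fib_cassini (R : comPzRingType) (a : R) k :
  fib a k * fib a k.+2 - fib a k.+1 ^+ 2 = (-1) ^+ k.+1.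
Proof.
elim: k => [|k IH]; first by rewrite /= mul0r sub0r !expr1n.
by rewrite [RHS]exprS -IH (fibSS a k.+1) (fibSS a k); ring.
Qed.

Lemma size_fib (F : fieldType) (c : F) k :
  size (fib ('X + c%:P) k) = k /\ fib ('X + c%:P) k.+1 \is monic.
Proof.
elim/ltn_ind: k => -[_|[_|k IH]]; first by rewrite size_poly0 monic1.
  by rewrite /= size_poly1 add0r mul1r monicXaddC.
have [s0 m1] := IH k (ltnW (leqnn _)); have [s1 m2] := IH k.+1 (leqnn _).
have szM j : fib ('X + c%:P) j.+1 \is monic -> size (fib ('X + c%:P) j.+1 * ('X + c%:P)) = (size (fib ('X + c%:P) j.+1)).+1.
  by move=> mj; rewrite size_Mmonic ?monic_neq0 ?monicXaddC // size_XaddC addn2.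
have s2 : size (fib ('X + c%:P) k.+2) = k.+2.
  by rewrite fibSS addrC size_polyDl (szM _ m1) s1 // s0.
split=> //; rewrite fibSS addrC monicE lead_coefDl ?(szM _ m2) ?s2 ?s1 // -monicE.
by rewrite rpredM // monicXaddC.
Qed.

(** A root z of X^2 + cX - 1 is nonzero and gives c = 1/z - z. There are only q - 1 candidates for
    z, so some c among the q elements is missed. *)
Lemma exists_anisotropic (F : finFieldType) :
  exists c : F, forall x y, x ^+ 2 + c * x * y - y ^+ 2 = 0 -> x = 0 /\ y = 0.
Proof.
have [c hc] : exists c : F, c \notin [seq x^-1 - x | x in [pred x : F | x != 0]].
  apply: contrapT => H.
  have sub : F \subset [seq x^-1 - x | x in [pred x : F | x != 0]].
    by apply/fintype.subsetP => c _; apply: contrapT => /negP nc; apply: H; exists c.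
  have := leq_trans (subset_leq_card sub) (leq_image_card _ _).
  rewrite (eq_card (_ : [pred x : F | x != 0] =i predC1 0)) // cardC1.
  by have : (0 < #|F|)%N; [apply/card_gt0P; exists 0 | case: #|F| => // m; rewrite ltnn].
exists c => x y E; have [y0 | y0] := eqVneq y 0.
  by move/eqP: E; rewrite y0 mulr0 expr0n /= subr0 addr0 expf_eq0 => /eqP.
have [x0 | x0] := eqVneq x 0.
  by move/eqP: E; rewrite x0 mulr0 mul0r expr0n /= !add0r oppr_eq0 expf_eq0 (negPf y0).
case/negP: hc; apply/fintype.imageP; exists (x / y).
  by rewrite inE mulf_neq0 ?invr_eq0.
apply: (mulIf (mulf_neq0 x0 y0)); rewrite invf_div.
have -> : (y / x - x / y) * (x * y) = y ^+ 2 - x ^+ 2 by field; rewrite x0 y0.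
by apply/eqP; rewrite -subr_eq0 -E; apply/eqP; ring.
Qed.

Lemma lead_coef_at (R : nzRingType) (p : {poly R}) w :
  p`_w != 0 -> (forall i, (w < i)%N -> p`_i = 0) -> lead_coef p = p`_w.
Proof.
move=> pw ph; have -> : lead_coef p = p`_(size p).-1 by [].
suff -> : size p = w.+1 by [].
apply/eqP; rewrite eqn_leq; apply/andP; split; first exact/leq_sizeP.
by rewrite ltnNge; apply: contra pw => /leq_sizeP ->.
Qed.

Section Params.
Variables (F : finFieldType) (r l : nat) (c : F) (e b d : {poly F}).
Hypothesis r_gt1 : (1 < r)%N.
(* The equation of a fixed point of x |-> (e x^r + b) / (b x^r + d). *)
Definition hyperquad : {poly {poly F}} :=
  b *: 'X^(r.+1) - e *: 'X^r + d *: 'X - b%:P.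

Lemma horner_hyperquad (K : comNzRingType) (phi : {rmorphism {poly F} -> K}) x :
  (map_poly phi hyperquad).[x] =
  phi b * x ^+ r.+1 - phi e * x ^+ r + phi d * x - phi b.
Proof.
rewrite /hyperquad !(rmorphB, rmorphD) /= !map_polyZ map_polyC /= !map_polyXn map_polyX.
by rewrite !(hornerD, hornerN, hornerZ, hornerXn, hornerX, hornerC).
Qed.

Lemma coef_hyperquad j : hyperquad`_j =
  b *+ (j == r.+1) - e *+ (j == r) + d *+ (j == 1%N) - b *+ (j == 0%N).
Proof.
rewrite /hyperquad coefB coefD coefB !coefZ !coefXn coefX coefC.
by rewrite !mulr_natr -mulrb.
Qed.

Lemma coef_hyperquad_cases : [/\ hyperquad`_r.+1 = b, hyperquad`_r = - e,
   hyperquad`_1 = d & hyperquad`_0 = - b].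
Proof.
rewrite !coef_hyperquad !eqxx !eqSS.
have [-> -> -> ->] : [/\ (r == 0%N) = false, (r == 1%N) = false, (r == r.+1) = false & (1%N == r) = false].
  by split; lia.
have [-> -> ->] : [/\ (r.+1 == r) = false, (0%N == r) = false & (1 == 0)%N = false].
  by split; lia.
rewrite !mulr0n !mulr1n /= !addr0 !subr0 !sub0r !add0r; split=> //.
Qed.

Lemma size_hyperquad : b != 0 -> size hyperquad = r.+2.
Proof.
move=> bn0; apply/eqP; rewrite eqn_leq; apply/andP; split; last first.
  rewrite ltnNge; apply/negP => /leq_sizeP/(_ _ (leqnn _)).
  by have [-> _ _ _] := coef_hyperquad_cases; apply/eqP.
apply/leq_sizeP => j lj; rewrite coef_hyperquad.
have [-> -> -> ->] : [/\ (j == 0%N) = false, (j == 1%N) = false, (j == r.+1) = false & (j == r) = false].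
  by split; lia.
by rewrite !mulr0n !subr0 addr0.
Qed.

Lemma hyperquad_form x y :
  \sum_(i < r.+2) hyperquad`_i * x ^+ i * y ^+ (r.+1 - i) =
  b * x ^+ r.+1 - e * x ^+ r * y + d * x * y ^+ r - b * y ^+ r.+1.
Proof.
have term (a : {poly F}) j : (j < r.+2)%N ->
    \sum_(i < r.+2) (a *+ (i == j :> nat)) * x ^+ i * y ^+ (r.+1 - i) = a * x ^+ j * y ^+ (r.+1 - j).
  move=> lj; rewrite (bigD1 (Ordinal lj)) //= eqxx big1 ?addr0 // => i.
  by rewrite -val_eqE /= => /negPf ->; rewrite mulr0n !mul0r.
under eq_bigr do rewrite coef_hyperquad !(mulrDl, mulNr).
rewrite !big_split /= !sumrN !term ?ltnS ?leqnSn //.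
by rewrite subnn subn0 subSnn subSS subn0 expr0 !mulr1 expr1.
Qed.

Hypothesis FrF : forall x : F, x ^+ r = x.
Hypothesis l_gt0 : (0 < l)%N.
Hypothesis dE : d = e + b * ('X + c%:P).
Hypothesis det1 : (e * d - b ^+ 2) ^+ 2 = 1.
Hypothesis sd : size d = l.+1.
Hypothesis sb : size b = l.
Hypothesis se : (size e < l)%N.
Hypothesis md : d \is monic.
Hypothesis mb : b \is monic.
Hypothesis b0 : b.[0] != 0.
Hypothesis anis : forall x y : F, x ^+ 2 + c * x * y - y ^+ 2 = 0 -> x = 0 /\ y = 0.

(** At T = 0 the exponent r acts on constants as the exponent 1, and d - e = b (T + c); the form
    reduces to b(0) (x^2 + cxy - y^2), which is anisotropic. *)
Lemma hyperquad_no_zero x y :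
  \sum_(i < r.+2) hyperquad`_i * x ^+ i * y ^+ (r.+1 - i) = 0 -> x = 0 /\ y = 0.
Proof.
move: x y; apply: (@homogeneous_zero _ r.+1 (fun x y =>
  \sum_(i < r.+2) hyperquad`_i * x ^+ i * y ^+ (r.+1 - i))) => [a x y|x y].
  rewrite mulr_sumr; apply: eq_bigr => i _.
  have -> : a ^+ r.+1 = a ^+ i * a ^+ (r.+1 - i) by rewrite -exprD subnKC // -ltnS.
  by rewrite !exprMn; ring.
rewrite hyperquad_form => /(congr1 (fun p => p.[0])).
rewrite !(hornerD, hornerN, hornerM, horner_exp) !exprS !FrF horner0.
rewrite dE hornerD hornerM hornerD hornerX hornerC => E; apply: anis.
apply: (mulfI b0); rewrite mulr0 -[RHS]E; ring.
Qed.

(** With weight rm + j for T^m X^j, the terms b X^(r+1) and d X both reach the top weight rl + 1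
    with coefficient 1, while e X^r and the constant term b stay below it. *)
Lemma lead_weigh_hyperquad : lead_coef (weigh r hyperquad) = 'X^(r.+1) + 'X.
Proof.
have r0 : (0 < r)%N by lia.
have bl : b`_l.-1 = 1 by move/monicP: mb; rewrite lead_coefE sb.
have dl : d`_l = 1 by move/monicP: md; rewrite lead_coefE sd.
have H w j : (r * l + 1 <= w)%N -> ((weigh r hyperquad)`_w)`_j =
    (((j == r.+1) || (j == 1%N)) && (w == r * l + 1)%N)%:R.
  move=> lw; have [N1 N2 N3 N4] := coef_hyperquad_cases; rewrite coef_weigh //.
  have [->|j0] := eqVneq j 0%N.
    rewrite N4 coefN subn0 /=; case: ifP => // /dvdnP[k wk].
    by rewrite wk mulnK // [b`_ _]nth_default ?oppr0 // sb; nia.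
  have [->|j1] := eqVneq j 1%N.
    rewrite N3 orbT /=; have -> : (0 < w)%N by lia.
    case: ifP => [/dvdnP[k wk]|]; last first.
      case: eqP => // ->; rewrite addnK dvdn_mulr //.
    rewrite wk mulnK //; have [kl|kl] := eqVneq k l.
      by rewrite kl dl (_ : (w == _) = true) //; apply/eqP; nia.
    rewrite [d`_ _]nth_default ?sd; last by nia.
    by case: eqP => // wE; case/eqP: kl; nia.
  have [->|jr1] := eqVneq j r.+1.
    rewrite N1 /=; case: ifP => [/andP[rw /dvdnP[k wk]]|].
      rewrite wk mulnK //; have [kl|kl] := eqVneq k l.-1.
        by rewrite kl bl (_ : (w == _) = true) //; apply/eqP; nia.
      rewrite [b`_ _]nth_default ?sb; last by nia.
      by case: eqP => // wE; case/eqP: kl; nia.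
    case: eqP => // -> /negP[]; apply/andP; split; first by nia.
    by rewrite -(prednK l_gt0) mulnS addnAC addn1 addKn dvdn_mulr.
  have [->|jr] := eqVneq j r.
    rewrite N2 coefN; case: ifP => //= /andP[rw /dvdnP[k wk]].
      by rewrite wk mulnK // [e`_ _]nth_default ?oppr0 // (leq_trans (ltnW se)) //; nia.
    have -> : hyperquad`_j = 0.
  rewrite coef_hyperquad (negPf j0) (negPf j1) (negPf jr1) (negPf jr).
  by rewrite !mulr0n !subr0 addr0.
  by rewrite coef0 if_same.
have E : (weigh r hyperquad)`_(r * l + 1) = 'X^(r.+1) + 'X.
  apply/polyP => j; rewrite H // eqxx andbT coefD coefXn coefX.
  have [->|_] := eqVneq j r.+1; last by rewrite add0r.
  by rewrite eqSS (gtn_eqF r0) addr0.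
rewrite -E; apply: lead_coef_at => [|w lw].
  rewrite E; apply: contraTneq isT => /polyP/(_ 1%N); rewrite coefD coefXn coefX coef0 eqxx.
  by rewrite eqSS (ltn_eqF r0) add0r => /eqP; rewrite oner_eq0.
apply/polyP => j; rewrite H ?coef0; last by lia.
by rewrite (_ : (w == _) = false) ?andbF //; lia.
Qed.

Lemma primitive_of_coprime_coefs (P : {poly {poly F}}) (u v : {poly F}) i j :
  (u * P`_i + v * P`_j) ^+ 2 = 1 -> primitiveTX P.
Proof.
move=> E a aP; have : a %| 1.
  rewrite -E dvdp_mulr //.
  by rewrite dvdp_add // dvdp_mull.
by rewrite dvdp1 => /eqP ->.
Qed.

Lemma hyperquad_primitive : primitiveTX hyperquad.
Proof.
have [N1 N2 _ _] := coef_hyperquad_cases.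
apply: (@primitive_of_coprime_coefs _ (- b) (- d) r.+1 r).
by rewrite N1 N2 -det1; ring.
Qed.

(** The Newton edge leaves a factor of degree at most 1 in X. Degree 1 would yield a zero of the
    homogenized equation, and in degree 0 primitivity makes the factor a unit. *)
Lemma minpoly_shape_hyperquad : minpoly_shape hyperquad.
Proof.
have sN := size_hyperquad (monic_neq0 mb).
have N0 : hyperquad != 0 by rewrite -size_poly_gt0 sN.
have small U V : hyperquad = U * V -> (size V <= 2)%N -> V \is a GRing.unit.
  move=> NE; case sV: (size V) => [|[|[|//]]] _.
  - by move/eqP: sV; rewrite size_poly_eq0 => /eqP V0; rewrite NE V0 mulr0 eqxx in N0.
  - have /eqP/size_poly1P[v v0 VE] := sV.
    rewrite VE rmorph_unit // poly_unitE.
    have sv : size v == 1%N.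
      rewrite eqn_leq size_poly_gt0 v0 andbT; apply: hyperquad_primitive => i.
      by rewrite NE VE coefMC dvdp_mull.
    rewrite sv unitfE; apply: contraNneq v0 => v00.
    by rewrite (size1_polyC (_ : size v <= 1)%N) ?(eqP sv) // v00.
  - have [|x [y [y0 /(_ r.+1)]]] := @linear_factor_zero _ 1 hyperquad U V (oner_neq0 _) _ sV.
      by rewrite scale1r.
    rewrite sN => /(_ (leqnn _))/hyperquad_no_zero[_ y00].
    by rewrite y00 eqxx in y0.
split; first by rewrite sN.
split; last first.
  split; first exact: hyperquad_primitive.
  have -> : lead_coef hyperquad = b; last exact: mb.
  by have [<- _ _ _] := coef_hyperquad_cases; rewrite lead_coefE sN.
split=> //; split.
  by apply/negP; rewrite poly_unitE sN.
move=> U V NE.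
have := @newton_edge_factor _ r U V (ltnW r_gt1).
rewrite -NE lead_weigh_hyperquad sN => /(_ erefl (leqnn _))[sU|sV].
- by left; apply: (small V U) => //; rewrite mulrC.
- by right; apply: (small U V).
Qed.

End Params.

(** * The sequence of quadratic forms *)

Definition qform (R : comPzRingType) (f : R * R * R) (x y : R) : R :=
  f.1.1 * x ^+ 2 + f.1.2 * x * y + f.2 * y ^+ 2.

Definition qdisc (R : comPzRingType) (f : R * R * R) : R :=
  f.1.2 ^+ 2 - 4 * f.1.1 * f.2.

Definition qpoly (R : comNzRingType) (f : R * R * R) : {poly R} :=
  f.1.1 *: 'X^2 + f.1.2 *: 'X + f.2%:P.

(** The substituted matrix is (d -b; -b e), the adjugate of (e b; b d). *)
Definition qsubst (R : comPzRingType) (e b d : R) (f : R * R * R) : R * R * R :=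
  (f.1.1 * d ^+ 2 - f.1.2 * b * d + f.2 * b ^+ 2,
   - (2 * f.1.1 * b * d) + f.1.2 * (e * d + b ^+ 2) - 2 * f.2 * b * e,
   f.1.1 * b ^+ 2 - f.1.2 * b * e + f.2 * e ^+ 2).

Definition qpow (R : comPzRingType) (r : nat) (f : R * R * R) : R * R * R :=
  (f.1.1 ^+ r, f.1.2 ^+ r, f.2 ^+ r).

Lemma qform_subst (R : comPzRingType) (e b d : R) f x y :
  qform (qsubst e b d f) x y = qform f (d * x - b * y) (e * y - b * x).
Proof. rewrite /qform /=; ring. Qed.

Lemma qdisc_subst (R : comPzRingType) (e b d : R) f :
  qdisc (qsubst e b d f) = (e * d - b ^+ 2) ^+ 2 * qdisc f.
Proof. rewrite /qdisc /=; ring. Qed.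

(** Substituting (e b; b d) undoes the adjugate up to the squared determinant. When that square is
    1, divisibility can be carried back from P_(k+1) to the twist of P_k. *)
Lemma qsubst_adj (R : comPzRingType) (e b d : R) f :
  qsubst d (- b) e (qsubst e b d f) =
  ((e * d - b ^+ 2) ^+ 2 * f.1.1, (e * d - b ^+ 2) ^+ 2 * f.1.2,
   (e * d - b ^+ 2) ^+ 2 * f.2).
Proof. by rewrite /qsubst /=; congr ((_, _), _); ring. Qed.

Lemma coef_qpoly (R : comNzRingType) (f : R * R * R) :
  [/\ (qpoly f)`_0 = f.2, (qpoly f)`_1 = f.1.2, (qpoly f)`_2 = f.1.1 &
   forall i, (2 < i)%N -> (qpoly f)`_i = 0].
Proof.
rewrite /qpoly; split=> [||| i i2]; rewrite !coefD !coefZ coefXn coefX coefC.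
- by rewrite /= !mulr0 !add0r.
- by rewrite /= mulr0 mulr1 add0r addr0.
- by rewrite /= mulr0 mulr1 !addr0.
- by case: i i2 => [|[|[|i]]] //= _; rewrite !mulr0 !addr0.
Qed.

Lemma size_qpoly (R : comNzRingType) (f : R * R * R) :
  f.1.1 != 0 -> size (qpoly f) = 3%N.
Proof.
have [_ _ f2 fi] := coef_qpoly f; move=> f0.
apply/eqP; rewrite eqn_leq; apply/andP; split; first by apply/leq_sizeP => j; exact: fi.
by rewrite ltnNge; apply/negP => /leq_sizeP/(_ 2%N (leqnn _)); apply/eqP; rewrite f2.
Qed.

Lemma dvdp_qsubst (F : fieldType) (q e b d : {poly F}) f :
  q %| f.1.1 -> q %| f.1.2 -> q %| f.2 ->
  [/\ q %| (qsubst e b d f).1.1, q %| (qsubst e b d f).1.2 & q %| (qsubst e b d f).2].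
Proof.
move=> q2 q1 q0; split; rewrite /qsubst /=.
- by rewrite dvdp_add ?dvdp_sub ?dvdp_mulr.
- rewrite dvdp_sub ?dvdp_add ?dvdpNr ?(dvdp_mulr (e * d + _)) //.
    by apply: dvdp_mulr; apply: dvdp_mulr; apply: dvdp_mull.
  by apply: dvdp_mulr; apply: dvdp_mulr; apply: dvdp_mull.
- by rewrite dvdp_add ?dvdp_sub ?dvdp_mulr.
Qed.

Section Forms.
Variables (F : finFieldType) (r : nat) (c : F) (e b d : {poly F}).
Hypothesis r_pchar : [pchar F].-nat r.
Hypothesis FrF : forall x : F, x ^+ r = x.
Hypothesis det1 : (e * d - b ^+ 2) ^+ 2 = 1.
Hypothesis anis : forall x y : F, x ^+ 2 + c * x * y - y ^+ 2 = 0 -> x = 0 /\ y = 0.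

Definition qseq k : {poly F} * {poly F} * {poly F} :=
  iter k (fun f => qsubst e b d (qpow r f)) (1, 'X + c%:P, -1).

Lemma qseqS k : qseq k.+1 = qsubst e b d (qpow r (qseq k)).
Proof. by []. Qed.

Lemma qform_horner0 (f : {poly F} * {poly F} * {poly F}) x y :
  (qform f x y).[0] = qform (f.1.1.[0], f.1.2.[0], f.2.[0]) x.[0] y.[0].
Proof. by rewrite /qform !hornerE. Qed.

(** At T = 0 the Frobenius twist is trivial and the substitution is invertible over F, so every P_k
    reduces to a form equivalent to the anisotropic x^2 + cxy - y^2. *)
Lemma qseq_anisotropic0 k (x y : {poly F}) :
  (qform (qseq k) x y).[0] = 0 -> x.[0] = 0 /\ y.[0] = 0.
Proof.
elim: k x y => [|k IH] x y.
  have h1 : (1 : {poly F}).[0] = 1 by rewrite -[1]/(1%:P) hornerC.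
  rewrite qform_horner0 /qform /= hornerD hornerX hornerN hornerC h1 add0r.
  by rewrite mul1r mulN1r => E; apply: anis.
have FrP (a : {poly F}) : (a ^+ r).[0] = a.[0] by rewrite horner_exp FrF.
rewrite qseqS qform_subst qform_horner0 /= !FrP -qform_horner0 => /IH[].
have D0 : (e.[0] * d.[0] - b.[0] ^+ 2) ^+ 2 = 1.
  by have := congr1 (fun a => a.[0]) det1; rewrite !hornerE.
have : e.[0] * d.[0] - b.[0] ^+ 2 != 0.
  by apply: contraTneq isT => D00; move/eqP: D0; rewrite D00 expr0n /= eq_sym oner_eq0.
rewrite !hornerE; move: (e.[0]) (b.[0]) (d.[0]) (x.[0]) (y.[0]) => e0 b0 d0 x0 y0.
move=> Dn0 xy1 xy2; split; apply: (mulfI Dn0); rewrite mulr0.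
  have -> : (e0 * d0 - b0 ^+ 2) * x0 = e0 * (d0 * x0 - b0 * y0) + b0 * (e0 * y0 - b0 * x0) by ring.
  by rewrite xy1 xy2 !mulr0 addr0.
have -> : (e0 * d0 - b0 ^+ 2) * y0 = b0 * (d0 * x0 - b0 * y0) + d0 * (e0 * y0 - b0 * x0) by ring.
by rewrite xy1 xy2 !mulr0 addr0.
Qed.

Lemma qseq_anisotropic k (x y : {poly F}) : qform (qseq k) x y = 0 -> x = 0 /\ y = 0.
Proof.
move: x y; apply: (@homogeneous_zero _ 2 (qform (qseq k))) => [a x y|x y E].
  by rewrite /qform; ring.
by apply: (@qseq_anisotropic0 k); rewrite E horner0.
Qed.

Lemma qseq_lead_neq0 k : (qseq k).1.1 != 0.
Proof.
apply/eqP => u0; have [] := @qseq_anisotropic k 1 0; last by move/eqP; rewrite oner_eq0.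
by rewrite /qform u0 mulr0 expr0n /= !mulr0 mul0r !addr0.
Qed.

(** An irreducible q dividing the coefficients of P_(k+1) divides their images under the inverse
    substitution, which are r-th powers of the coefficients of P_k. Descent ends at P_0, whose
    leading coefficient is 1. *)
Lemma qseq_primitive k a :
  a %| (qseq k).1.1 -> a %| (qseq k).1.2 -> a %| (qseq k).2 -> (size a <= 1)%N.
Proof.
move=> a2 a1 a0; rewrite leqNgt; apply/negP => sa.
have [q irq qa] := irreducible_factor sa; move: (dvdp_trans qa a2) (dvdp_trans qa a1) (dvdp_trans qa a0).
elim: k {a2 a1 a0} => [|k IH] q2 q1 q0.
  by have := irq.1; have /eqP-> : size q == 1%N by rewrite -dvdp1.
have [E2 E1 E0] : [/\ (qseq k).1.1 ^+ r = (qsubst d (- b) e (qseq k.+1)).1.1,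
   (qseq k).1.2 ^+ r = (qsubst d (- b) e (qseq k.+1)).1.2 &
   (qseq k).2 ^+ r = (qsubst d (- b) e (qseq k.+1)).2].
  by split; rewrite qseqS qsubst_adj det1 /= mul1r.
have [Q2 Q1 Q0] := dvdp_qsubst d (- b) e q2 q1 q0.
by apply: IH; apply: (@irreducible_dvdX _ _ _ r) => //; rewrite ?E2 ?E1 ?E0.
Qed.

(** The substitution multiplies the discriminant by the squared determinant, which is 1, and the
    twist raises it to the power r because 4 and -1 lie in the field fixed by Frobenius. *)
Lemma qseq_disc k : qdisc (qseq k) = qdisc (1, 'X + c%:P, -1) ^+ (r ^ k).
Proof.
elim: k => [|k IH]; first by rewrite expn0 expr1.
have r_pcharP : [pchar {poly F}].-nat r by rewrite (eq_pnat _ (pchar_lalg _)).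
have four : (4 : {poly F}) ^+ r = 4.
  have -> : (4 : {poly F}) = (4 : F)%:P by rewrite polyC_natr.
  by rewrite -polyC_exp FrF.
have oppr_r : (-1 : {poly F}) ^+ r = -1 by rewrite -polyCN -polyC_exp FrF.
rewrite qseqS qdisc_subst det1 mul1r expnSr exprM -IH /qdisc /=.
move: (qseq k) => [[x y] z] /=.
rewrite [RHS]exprDn_pchar // [in RHS]exprAC; congr (_ + _).
by rewrite -[in RHS]mulN1r !exprMn oppr_r four mulN1r.
Qed.

(** A vanishing resultant gives a common factor over F(T). It is not linear, since P_k is
    anisotropic, so P_k divides Q over F(T). By Gauss's lemma, irreducibility of Q and primitivity
    of P_k, the quotient is a constant. *)
Lemma qpoly_resultant0 k (Q : {poly {poly F}}) : minpoly_shape Q ->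
  resultant (qpoly (qseq k)) Q = 0 -> exists2 v : F, v != 0 & Q = v%:P *: qpoly (qseq k).
Proof.
set P := qpoly _ => -[sQ [[Q0 [nuQ irQ]] [prQ _]]] /eqP.
have sP : size P = 3%N by rewrite size_qpoly ?qseq_lead_neq0.
have P0 : P != 0 by rewrite -size_poly_gt0 sP.
rewrite resultant_eq0; set g := gcdp _ _ => sg.
have /Pdiv.Idomain.dvdpP[[c1 q1] /= c10 c1P] : Pdiv.Idomain.dvdp g P by exact: dvdp_gcdl.
have /Pdiv.Idomain.dvdpP[[c2 q2] /= c20 c2Q] : Pdiv.Idomain.dvdp g Q by exact: dvdp_gcdr.
have sg3 : (size g <= 3)%N by rewrite -sP Pdiv.Idomain.dvdp_leq ?dvdp_gcdl.
have q10 : q1 != 0.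
  apply: contraTneq isT => q10; move/eqP: c1P; rewrite q10 mul0r.
  by rewrite -mul_polyC mulf_eq0 polyC_eq0 (negPf c10) (negPf P0).
have g0 : g != 0 by rewrite -size_poly_gt0 (leq_trans _ sg).
have sq : (size q1 + size g = 4)%N.
  have := size_mul q10 g0; rewrite -c1P -mul_polyC size_Cmul // sP.
  by move: (size_poly_gt0 q1); rewrite q10; case: (size q1) => // a _; rewrite addSn /= => ->.
have [s2 | s3] := eqVneq (size g) 2.
  have [x [y [y0 /(_ 2%N)]]] := linear_factor_zero c10 c1P s2.
  rewrite sP => /(_ (leqnn _)); have [C0 C1 C2 _] := coef_qpoly (qseq k).
  rewrite 2!big_ord_recr big_ord1 /= C0 C1 C2 => E.
  have [|_ y00] := @qseq_anisotropic k x y; last by rewrite y00 eqxx in y0.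
  by rewrite /qform -[RHS]E; ring.
have /size_poly1P[q q0 q1E] : size q1 == 1%N.
  by move: sg sg3 sq s3; case: (size g) => [|[|[|[|]]]] // _ _ /eqP; rewrite addn3.
(* Here q1 is the constant q in X, so eliminating the gcd between the two divisibilities gives c2 q
   Q = c1 q2 P_k. *)
have [||u [v [U [V [u0 v0 UE VE QE]]]]] := @gauss_factor _ (c2 * q) Q (c1 *: q2) P.
- by rewrite mulf_neq0.
- rewrite -scalerAl scalerAr c1P q1E mul_polyC -scalerAr -c2Q.
  by rewrite scalerA mulrC.
have sV : size V = 3%N by rewrite -sP VE -mul_polyC size_Cmul.
have [Uu | ] := irQ U V QE; last by rewrite poly_unitE sV.
have /size_poly1P[w w0 vE] : size v == 1%N.
  rewrite eqn_leq size_poly_gt0 v0 andbT.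
  have [C0 C1 C2 _] := coef_qpoly (qseq k).
  by apply: (@qseq_primitive k); rewrite -?C0 -?C1 -?C2 -/P VE coefZ dvdp_mulr.
have /andP[/size_poly1P[a a0 aE]] : (size U == 1%N) && (U`_0 \is a GRing.unit).
  by move: Uu; rewrite poly_unitE.
rewrite aE coefC /= poly_unitE => /andP[/size_poly1P[a' a'0 a'E] _].
exists (a' / w); first by rewrite mulf_neq0 ?invr_eq0.
by rewrite QE VE aE a'E vE mul_polyC scalerA -polyCM divfK.
Qed.

End Forms.

(** * Laurent series *)

Section LaurentCoef.
Variable F : finFieldType.
Implicit Types (x y : laurent F) (a : {poly F}).

Lemma lcoef_lt x m : m < lstart x -> lcoef x m = 0.
Proof. by rewrite /lcoef leNgt => ->. Qed.

Lemma lcoef_start x (k : nat) : lcoef x (lstart x + k%:Z) = lseq x k.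
Proof. by rewrite /lcoef lerDl /= addrAC subrr add0r. Qed.

Lemma ltz_or_shift (s m : int) : (m < s) \/ exists k : nat, m = s + k%:Z.
Proof. by case: (ltP m s) => h; [left | right; exists `|m - s|%N; lia]. Qed.

Lemma lcoef_lzero m : lcoef (lzero F) m = 0.
Proof. by rewrite /lcoef /=; case: ifP. Qed.

Lemma lcoef_ladd x y m : lcoef (ladd x y) m = lcoef x m + lcoef y m.
Proof.
have [lm | [k ->]] := ltz_or_shift (lstart (ladd x y)) m; last by rewrite lcoef_start.
rewrite !lcoef_lt ?addr0 //; move: lm => /=; rewrite lt_min => /andP[] //.
Qed.

Lemma lcoef_lpoly a m : lcoef (lpoly a) m = if m <= 0 then a`_`|m| else 0.
Proof.
have [lm | [k ->]] := ltz_or_shift (lstart (lpoly a)) m.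
  rewrite lcoef_lt //; case: ifP => // m0; rewrite nth_default //.
  by move: lm => /=; lia.
rewrite lcoef_start /=; have -> : (- (size a)%:Z + k%:Z <= 0) = (k <= size a)%N by lia.
by case: ifP => // ks; congr (a`_ _); lia.
Qed.

Lemma lcoef_lmul_lpoly a y m B : (size a <= B)%N ->
  lcoef (lmul (lpoly a) y) m = \sum_(j < B) a`_j * lcoef y (m + j%:Z).
Proof.
move=> sB.
(* [lpoly a] carries [size a] + 1 digits, the first being the zero coefficient of T^(size a); the
   sum is first brought to that length. *)
have -> : \sum_(j < B) a`_j * lcoef y (m + j%:Z) =
          \sum_(j < (size a).+1) a`_j * lcoef y (m + j%:Z).
  rewrite big_ord_recr /= [a`_(size a)]nth_default // mul0r addr0.
  rewrite (big_ord_widen _ (fun j : nat => a`_j * lcoef y (m + j%:Z)) sB).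
  rewrite [RHS]big_mkcond; apply: eq_bigr => j _ /=.
  by case: ltnP => // sj; rewrite nth_default ?mul0r.
have [lm | [k ->]] := ltz_or_shift (lstart (lmul (lpoly a) y)) m.
  rewrite lcoef_lt // big1 // => j _; rewrite lcoef_lt ?mulr0 //.
  by case: j lm => j; rewrite /= ltnS; move: (size a) => n; lia.
rewrite lcoef_start [RHS](reindex_inj rev_ord_inj) /=.
pose f i := (if (i <= size a)%N then a`_(size a - i) else 0) *
  (if (i <= k)%N then lseq y (k - i) else 0).
transitivity (\sum_(i < (k + size a).+1) f i).
  rewrite (big_ord_widen (k + size a).+1 (fun i => (if (i <= size a)%N then a`_(size a - i) else 0) * lseq y (k - i))); last by rewrite ltnS leq_addr.
  rewrite big_mkcond; apply: eq_bigr => i _; rewrite /f ltnS.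
  by case: ifP => _ //; rewrite mulr0.
symmetry; rewrite (big_ord_widen (k + size a).+1 (fun i => a`_((size a).+1 - i.+1) * lcoef y (- (size a)%:Z + lstart y + k%:Z + ((size a).+1 - i.+1)%N%:Z))); last by rewrite ltnS leq_addl.
rewrite big_mkcond; apply: eq_bigr => i _; rewrite /f ltnS subSS.
case: ifP => ia; last by rewrite mul0r.
congr (_ * _); move: (nat_of_ord i) ia => i'; move: (size a) => n ia.
case: leqP => ik; last by rewrite lcoef_lt //; lia.
by rewrite -lcoef_start; congr lcoef; lia.
Qed.

Lemma lcoef_bigladd I (s : seq I) (f : I -> laurent F) m :
  lcoef (\big[@ladd F/lzero F]_(i <- s) f i) m = \sum_(i <- s) lcoef (f i) m.
Proof.
by elim/big_rec2: _ => [|i u v _ <-]; rewrite ?lcoef_lzero ?lcoef_ladd.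
Qed.

Lemma lstart_lexp x i : lstart (lexp x i) = lstart x * i%:Z.
Proof. by elim: i => [|i IH] /=; rewrite ?mulr0 // IH; lia. Qed.

Lemma eq_lexp x y n : lstart x = lstart y ->
  (forall k, (k < n)%N -> lseq x k = lseq y k) ->
  forall i k, (k < n)%N -> lseq (lexp x i) k = lseq (lexp y i) k.
Proof.
move=> _ xy; elim=> [|i IH] k kn //=; apply: eq_bigr => j _.
by rewrite IH ?xy // (leq_ltn_trans _ kn) ?leq_subr // -ltnS.
Qed.

Lemma lcoef_lexp1 x m : lcoef (lexp x 1) m = lcoef x m.
Proof.
have sx : lstart (lexp x 1) = lstart x by rewrite lstart_lexp mulr1.
have [lm | ] := ltz_or_shift (lstart x) m; first by rewrite !lcoef_lt ?sx.
move=> [k ->]; rewrite -{1}sx !lcoef_start /= big_ord_recl /= subn0 mul1r.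
by rewrite big1 ?addr0 // => i _; rewrite mul0r.
Qed.

(** The linear coefficient is monic of degree l in T and all others have smaller degree. The
    vanishing of each coefficient of P(x) therefore expresses one digit of x through earlier digits,
    and the digits can be solved for in turn. *)
Lemma laurent_root (P : {poly {poly F}}) l : (1 < size P)%N ->
  P`_1 \is monic -> size P`_1 = l.+1 ->
  (forall i, i != 1%N -> (size (P`_i)%R <= l)%N) ->
  exists x : laurent F, lstart x = 1 /\ forall m, lcoef (leval P x) m = 0.
Proof.
move=> sP mP sP1 sPi.
pose E x m := \sum_(i < size P) \sum_(j < l) P`_i`_j * lcoef (lexp x i) (m + j%:Z).
(* The top coefficient 1 of P_1 isolates the digit of index m + l; [E] collects all remaining
   terms. *)
have EE x m : lcoef (leval P x) m = E x m + lcoef x (m + l%:Z).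
  rewrite /leval lcoef_bigladd.
  have -> : lcoef x (m + l%:Z) = \sum_(i < size P) P`_i`_l * lcoef (lexp x i) (m + l%:Z).
    rewrite (bigD1 (Ordinal sP)) //= big1 ?addr0.
      by move/monicP: mP; rewrite lead_coefE sP1 /= => ->; rewrite mul1r -[lmul _ _]/(lexp x 1) lcoef_lexp1.
    by move=> i; rewrite -val_eqE /= => /sPi si; rewrite nth_default ?mul0r.
  rewrite -big_split; apply: eq_bigr => i _ /=.
  rewrite (@lcoef_lmul_lpoly _ _ _ l.+1) ?big_ord_recr //.
  by have [->|/sPi/leqW] := eqVneq (i : nat) 1%N; rewrite ?sP1.
pose X (c : nat -> F) := Laurent 1 c.
pose Phi (c : nat -> F) k := - E (X c) (k.+1%:Z - l%:Z).
(* [Phi] is a contraction: agreement of the first n digits gives agreement of n + 1 digits. For i >=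
   1 the series x^i starts at index i, so digit k of [Phi c] sees only digits of c before k. *)
have agree n c c' : (forall k, (k < n)%N -> c k = c' k) ->
    forall k, (k < n.+1)%N -> Phi c k = Phi c' k.
  move=> cc k kn; congr (- _); apply: eq_bigr => i _; apply: eq_bigr => j _.
  congr (_ * _); set m := _ + _.
  case: (posnP i) => [->|i0]; first by [].
  have sX (c1 : nat -> F) : lstart (lexp (X c1) i) = i%:Z by rewrite lstart_lexp mul1r.
  have [lm | [k' mE]] := ltz_or_shift i%:Z m; first by rewrite !lcoef_lt ?sX.
  rewrite mE -{1}(sX c) -(sX c') !lcoef_start.
  apply: (@eq_lexp _ _ n) => //; have := ltn_ord j; move: mE; rewrite /m; lia.
pose s n := iter n Phi (fun _ => 0).
have sS n k : (k < n)%N -> s n k = s n.+1 k.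
  by elim: n k => // n IH k kn; apply: (agree n).
have sD n k j : (k < n)%N -> s n k = s (n + j)%N k.
  by move=> kn; elim: j => [|j IH]; rewrite ?addn0 // addnS -sS ?(leq_trans kn) ?leq_addr.
(* Digit k no longer changes from the iterate k + 1 on, so the diagonal is the fixed point. *)
pose c k := s k.+1 k.
have fixc k : Phi c k = c k.
  rewrite (agree k c (s k)) // => j jk.
  by rewrite /c (sD j.+1 j (k - j.+1)%N) // subnKC.
exists (X c); split=> // m; rewrite EE.
have [lm | [k mE]] := ltz_or_shift 1 (m + l%:Z).
  rewrite lcoef_lt // addr0 /E big1 // => i _; rewrite big1 // => j _.
  rewrite lcoef_lt ?mulr0 // lstart_lexp mul1r; have := ltn_ord j; lia.
rewrite mE -[1]/(lstart (X c)) lcoef_start /= -fixc /Phi.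
by rewrite (_ : m = k.+1%:Z - l%:Z) ?subrr //; lia.
Qed.

End LaurentCoef.

Section LaurentAbs.
Variables (R : realType) (F : finFieldType).
Let q : R := #|F|%:R.

Lemma card_gt1 : 1 < q.
Proof. by rewrite ltr1n finNzRing_gt1. Qed.

Lemma labs_eq0 (x : laurent F) : (forall m, lcoef x m = 0) -> labs R x = 0.
Proof.
move=> x0; rewrite /labs /lval; case: pselect => // h.
by exfalso; case: h => k; rewrite x0 eqxx.
Qed.

Lemma labs_lt1 (x : laurent F) : 1 <= lstart x -> labs R x < 1.
Proof.
move=> x1; rewrite /labs /lval; case: pselect => // h; rewrite -/q.
set n : int := - _; have n0 : n < 0 by rewrite /n; lia.
have [k ->] : exists k : nat, n = - k.+1%:Z by exists `|n|.-1%N; lia.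
have q0 : 0 < q := lt_trans ltr01 card_gt1.
rewrite -exprz_inv -exprnP exprn_ilt1 ?invr_ge0 ?(ltW q0) //.
by rewrite invf_lt1 // card_gt1.
Qed.

Lemma labs_lpoly (a : {poly F}) : labs R (lpoly a) = pabs R a.
Proof.
rewrite /pabs; have [->|a0] := eqVneq a 0.
  by apply: labs_eq0 => m; rewrite lcoef_lpoly coef0 if_same.
have sa : (0 < size a)%N by rewrite size_poly_gt0.
have h1 : lcoef (lpoly a) (lstart (lpoly a) + 1%:Z) != 0.
  rewrite lcoef_start /= sa subn1 -[X in X != 0]/(a`_(size a).-1).
  by rewrite -lead_coefE lead_coef_eq0.
rewrite /labs /lval; case: pselect => [h|]; last by case; exists 1%N.
case: ex_minnP => k hk mink; have k1 : (k <= 1)%N by apply: mink.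
(* The digit of index 0 is the coefficient of T^(size a), which vanishes; the leading coefficient
   sits at index 1. *)
have -> : k = 1%N.
  apply/eqP; rewrite eqn_leq k1 lt0n; apply: contraNneq hk => ->.
  by rewrite lcoef_start /= subn0 nth_default.
rewrite /= -/q (_ : - _ = ((size a).-1)%:Z) //.
by move: sa; move: (size a) => n; lia.
Qed.

End LaurentAbs.

(** * Ultrametric absolute values *)

Section Ultrametric.
Variables (R : realType) (K : fieldType) (abs : K -> R).
Hypothesis abs_ge0 : forall a, 0 <= abs a.
Hypothesis abs0 : abs 0 = 0.
Hypothesis abs_eq0 : forall a, abs a = 0 -> a = 0.
Hypothesis absM : forall a b, abs (a * b) = abs a * abs b.
Hypothesis absD : forall a b, abs (a + b) <= Num.max (abs a) (abs b).

Lemma abs1 : abs 1 = 1.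
Proof.
have a1 : abs 1 != 0 by apply/eqP => /abs_eq0 /eqP; rewrite oner_eq0.
by apply: (mulfI a1); rewrite -absM !mulr1.
Qed.

Lemma absX a n : abs (a ^+ n) = abs a ^+ n.
Proof. by elim: n => [|n IH]; rewrite ?expr0 ?abs1 // !exprS absM IH. Qed.

Lemma absN a : abs (- a) = abs a.
Proof.
have sq : abs (-1) ^+ 2 = 1 by rewrite -absX sqrrN expr1n abs1.
have : abs (-1) = 1 by apply/eqP; rewrite -(@eqrXn2 _ 2) // expr1n sq.
by move=> h; rewrite -mulN1r absM h mul1r.
Qed.

Lemma absD_le a b C : abs a <= C -> abs b <= C -> abs (a + b) <= C.
Proof. by move=> aC bC; apply: le_trans (absD a b) _; rewrite ge_max aC. Qed.

Lemma absB_le a b C : abs a <= C -> abs b <= C -> abs (a - b) <= C.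
Proof. by move=> aC bC; apply: absD_le; rewrite ?absN. Qed.

Lemma absD_lt a b C : abs a < C -> abs b < C -> abs (a + b) < C.
Proof. by move=> aC bC; apply: le_lt_trans (absD a b) _; rewrite gt_max aC. Qed.

Lemma absB_lt a b C : abs a < C -> abs b < C -> abs (a - b) < C.
Proof. by move=> aC bC; apply: absD_lt; rewrite ?absN. Qed.

Lemma absD_dominant a b : abs b < abs a -> abs (a + b) = abs a.
Proof.
move=> ba; apply/le_anti; rewrite absD_le //= ?(ltW ba) //.
rewrite leNgt; apply/negP => lt.
have := absB_lt lt ba; rewrite addrK ltxx //.
Qed.

Lemma absB_dominant a b : abs b < abs a -> abs (a - b) = abs a.
Proof. by move=> ba; rewrite absD_dominant ?absN. Qed.

Lemma abs_sum_le (I : Type) (s : seq I) (P : pred I) (f : I -> K) C : 0 <= C ->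
  (forall i, P i -> abs (f i) <= C) -> abs (\sum_(i <- s | P i) f i) <= C.
Proof.
move=> C0 fC; elim/big_rec: _ => [|i y Pi yC]; first by rewrite abs0.
by rewrite absD_le ?fC.
Qed.

Lemma abs_prod (I : Type) (s : seq I) (P : pred I) (f : I -> K) :
  abs (\prod_(i <- s | P i) f i) = \prod_(i <- s | P i) abs (f i).
Proof. by apply: big_morph; [exact: absM | exact: abs1]. Qed.

Lemma abs_sign n : abs ((-1) ^+ n) = 1.
Proof. by rewrite absX absN abs1 expr1n. Qed.

Lemma abs_natr_le1 n : abs n%:R <= 1.
Proof. by elim: n => [|n IH]; rewrite ?abs0 // -natr1 absD_le ?abs1. Qed.

(** Every term of the Leibniz expansion takes one entry from each row. *)
Lemma abs_det_le n (A : 'M[K]_n) (rho : 'I_n -> R) :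
  (forall i j, abs (A i j) <= rho i) -> abs (\det A) <= \prod_i rho i.
Proof.
move=> Ar; rewrite /determinant; apply: abs_sum_le.
  by case: n A rho Ar => [|n] A rho Ar; rewrite ?big_ord0 // prodr_ge0 // => i _; exact: le_trans (Ar i ord0).
move=> s _; rewrite absM abs_sign mul1r abs_prod.
by apply: ler_prod => i _; rewrite abs_ge0 Ar.
Qed.

(** The cofactor omits row i. The bound [rho i] is kept as a factor instead of a divisor because it
    may be zero. *)
Lemma abs_cofactor_le n (A : 'M[K]_n) (rho : 'I_n -> R) i j : 0 <= rho i ->
  (forall i j, abs (A i j) <= rho i) -> abs (cofactor A i j) * rho i <= \prod_i rho i.
Proof.
case: n A rho i j => [|n] A rho i j ri Ar; first by case: i ri.
rewrite /cofactor absM abs_sign mul1r (bigD1_ord i) //= mulrC ler_wpM2l //.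
by apply: abs_det_le => k k'; rewrite !mxE.
Qed.

(** The Sylvester matrix maps the column of powers of x to entries x^k P(x) and x^k Q(x). The
    adjugate then writes the resultant as a combination of these entries by cofactors, and each
    cofactor lacks one row, hence one factor [HP] or [HQ]. *)
Lemma abs_resultant_le (P Q : {poly K}) x HP HQ : abs x <= 1 -> 0 < HP -> 0 < HQ ->
  (0 < (size Q).-1 + (size P).-1)%N ->
  (forall i, abs P`_i <= HP) -> (forall i, abs Q`_i <= HQ) ->
  abs (resultant P Q) <=
    Num.max (HP ^+ (size Q).-2 * HQ ^+ (size P).-1 * abs P.[x])
            (HP ^+ (size Q).-1 * HQ ^+ (size P).-2 * abs Q.[x]).
Proof.
move=> x1 HP0 HQ0 mn0 PH QH.
set m := (size Q).-1; set n := (size P).-1; set C := Num.max _ _.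
pose S : 'M[K]_(m + n) := Sylvester_mx P Q.
pose v : 'cV[K]_(m + n) := \col_j x ^+ j.
pose rho (i : 'I_(m + n)) := match fintype.split i with inl _ => HP | inr _ => HQ end.
have rho0 i : 0 < rho i by rewrite /rho; case: fintype.split.
have Srho i j : abs (S i j) <= rho i.
  rewrite /S Sylvester_mxE /rho; case: fintype.split => k; case: leq;
    by rewrite ?mulr1n ?mulr0n ?abs0 ?PH ?QH ?(ltW HP0) ?(ltW HQ0).
have rowE : forall (T : {poly K}) (k : nat), (size T + k <= m + n)%N ->
    \sum_(j < m + n) (T`_(j - k) *+ (k <= j)%N) * x ^+ j = x ^+ k * T.[x].
  move=> T k sT; rewrite mulrC -hornerXn -hornerM (@horner_coef_wide _ (m + n)).
    by apply: eq_bigr => j _; rewrite coefMXn ltnNge; case: leqP; rewrite ?mulr1n ?mulr0n.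
  apply: leq_trans sT; have [->|T0] := eqVneq T 0; first by rewrite mul0r size_poly0.
  by rewrite size_mulXn // addnC.
have Sv i : (S *m v) i 0 = match fintype.split i with
    inl k => x ^+ k * P.[x] | inr k => x ^+ k * Q.[x] end.
  rewrite mxE; under eq_bigr do rewrite /S Sylvester_mxE mxE.
  case: (fintype.split i) => k.
    rewrite rowE //; apply: (@leq_trans (n.+1 + k)); first by rewrite leq_add2r leqSpred.
    by rewrite addSnnS addnC leq_add2r ltn_ord.
  rewrite rowE //; apply: (@leq_trans (m.+1 + k)); first by rewrite leq_add2r leqSpred.
  by rewrite addSnnS leq_add2l ltn_ord.
have prho : \prod_i rho i = HP ^+ m * HQ ^+ n.
  rewrite big_split_ord /=; congr (_ * _).
    under eq_bigr do rewrite /rho (unsplitK (inl _)).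
    by rewrite prodr_const card_ord.
  under eq_bigr do rewrite /rho (unsplitK (inr _)).
  by rewrite prodr_const card_ord.
have cof i j : abs (cofactor S i j) * rho i <= HP ^+ m * HQ ^+ n.
  by rewrite -prho; apply: abs_cofactor_le => //; exact: ltW.
(* The entry of index 0 of the column of powers is 1, so the row of index 0 of adj(S) S v is the
   determinant itself. *)
have : \det S = \sum_i (\adj S) (Ordinal mn0) i * (S *m v) i 0.
  have := congr1 (fun M : 'M_(m + n) => (M *m v) (Ordinal mn0) 0) (mul_adj_mx S).
  rewrite -mulmxA [in RHS]mul_scalar_mx => /esym; rewrite [in LHS]mxE [in LHS]mxE /= expr0 mulr1.
  by move=> ->; rewrite mxE.
rewrite -[resultant P Q]/(\det S) => ->; apply: abs_sum_le => [|i _].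
  by rewrite le_max mulr_ge0 // mulr_ge0 // exprn_ge0 // ltW.
have xk k T : abs (x ^+ k * T) <= abs T.
  by rewrite absM absX ler_piMl // exprn_ile1.
rewrite absM mxE; have := cof i (Ordinal mn0); rewrite Sv /rho /C le_max.
move: (abs (cofactor _ _ _)) (abs_ge0 (cofactor S i (Ordinal mn0))) => g g0.
case: (fintype.split i) => k gle; apply/orP; [left | right].
- apply: le_trans (ler_wpM2l g0 (xk k P.[x])) _; apply: ler_wpM2r => //.
  rewrite -(ler_pM2r HP0) (le_trans gle) // mulrAC -exprSr prednK //.
  by apply: leq_ltn_trans (ltn_ord k).
- apply: le_trans (ler_wpM2l g0 (xk k Q.[x])) _; apply: ler_wpM2r => //.
  rewrite -(ler_pM2r HQ0) (le_trans gle) // -mulrA -exprSr prednK //.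
  by apply: leq_ltn_trans (ltn_ord k).
Qed.

End Ultrametric.

(** * Exponent recursions *)

(** Exponents of q along the sequence P_k: the Frobenius twist multiplies them by r and the
    substitution adds s = 2l. *)
Fixpoint affine_iter (r s : nat) (z0 : nat) (k : nat) : nat :=
  if k is k'.+1 then (r * affine_iter r s z0 k' + s)%N else z0.

(** For r > 1, adding 2l / (r - 1) turns both sequences into geometric ones of ratio r, whose
    quotient is the constant 2lr / (r - 1 + 2l). This quotient is the approximation exponent of the
    P_k. *)
Lemma affine_iter_relation r l k : (0 < r)%N -> (0 < l)%N ->
  ((r.-1 + 2 * l) * affine_iter r (2 * l) (2 * l) k =
   2 * l * r * affine_iter r (2 * l) 1 k + 2 * l * (2 * l).-1)%N.
Proof.
case: r l => // r [|l] // _ _; elim: k => [|k IH] /=; first by nia.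
rewrite mulnDr mulnCA {}IH; nia.
Qed.

(** The quotient 2lr / (r - 1 + 2l) is at least r - 1 as soon as (r - 1)^2 <= 2l. *)
Lemma affine_iter_gap r l k : (0 < r)%N -> (r.-1 * r.-1 < 2 * l)%N ->
  (r.-1 * affine_iter r (2 * l) 1 k <= affine_iter r (2 * l) (2 * l) k)%N.
Proof.
move=> r0 rl; have := @affine_iter_relation r l k r0; have l0 : (0 < l)%N by case: (posnP l) rl => // ->; rewrite muln0.
move=> /(_ l0); move: (affine_iter _ _ _ _) (affine_iter _ _ _ _) => z h E.
have H : (r.-1 * (r.-1 + 2 * l) <= 2 * l * r)%N.
  case: r r0 rl E => // r _ rl _.
  by rewrite [r.+1.-1]/= mulnDr mulnS [(r * (2 * l))%N]mulnC leq_add2r ltnW.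
rewrite -(@leq_pmul2l (r.-1 + 2 * l)); last by lia.
rewrite E; apply: leq_trans (leq_addr _ _).
by rewrite mulnA; apply: leq_mul => //; rewrite mulnC.
Qed.

(** Both sides obey z |-> rz + 2l, so only k = 0 has content. The left side is the exponent in the
    lower bound for the distance to a root of P_(k+1), and the right side compares it with r times
    the exponent of the leading coefficient. *)
Lemma affine_iter_lead r l k : (1 < r)%N -> (0 < l)%N ->
  (affine_iter r (2 * l) (2 * l) k.+1 + r ^ k.+1 <=
   r * affine_iter r (2 * l) (r + (2 * l).-1) k + 2 * l)%N.
Proof.
move=> r1 l0; elim: k => [|k IH]; first by rewrite /= expn1; nia.
have -> : affine_iter r (2 * l) (2 * l) k.+2 = (r * affine_iter r (2 * l) (2 * l) k.+1 + 2 * l)%N by [].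
have -> : affine_iter r (2 * l) (r + (2 * l).-1) k.+1 = (r * affine_iter r (2 * l) (r + (2 * l).-1) k + 2 * l)%N by [].
rewrite expnS; nia.
Qed.

Lemma affine_iter_ge r s z k : (1 < r)%N -> (0 < s)%N -> (k <= affine_iter r s z k)%N.
Proof.
by move=> r1 s0; elim: k => //= k IH; nia.
Qed.

Lemma affine_iter_inj r s z : (1 < r)%N -> (0 < s)%N -> injective (affine_iter r s z).
Proof.
move=> r1 s0; have step k : (affine_iter r s z k < affine_iter r s z k.+1)%N by move=> /=; nia.
have mono : {homo affine_iter r s z : i j / (i < j)%N} by apply: homo_ltn => //; exact: ltn_trans.
by move=> i j E; case: (ltngtP i j) => // /mono; rewrite E ltnn.
Qed.

(* The hypothesis on [r] and [n] is [2 r n <= (r - 2) (r - n)] expanded. *)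
Lemma affine_iter_height r l n H k : (n < r)%N -> ((3 * n + 2) * r <= r * r + 2 * n)%N ->
  ((r - n) * affine_iter r (2 * l) 1 k <= 2 * H)%N ->
  (n * affine_iter r (2 * l) 1 k.+1 <= (r - 2) * H + 2 * l * n)%N.
Proof.
move=> nr rn hH; rewrite -(@leq_pmul2l (r - n)); last by lia.
rewrite /=; move: (affine_iter _ _ _ _) hH => h hH.
have [s rE] : exists s, r = (n + s)%N by exists (r - n)%N; lia.
have sE : (r - n)%N = s by lia.
rewrite {}sE in hH *.
have key : (2 * r * n <= (r - 2) * s)%N by nia.
nia.
Qed.

(** * Heights as powers of q *)

Section ValuedRing.
Variables (R : realType) (F : finFieldType).
Let q : R := #|F|%:R.

Lemma height_exp (P : {poly {poly F}}) : P != 0 ->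
  exists H : nat, [/\ height R P = q ^+ H, forall i, pabs R P`_i <= q ^+ H &
    exists2 i, P`_i != 0 & (size (P`_i)).-1 = H].
Proof.
move=> P0; pose H := (\max_(i < size P) (size (P`_i)%R).-1)%N; exists H.
have q1 : 1 < q := card_gt1 R F.
have s0 : (0 < size P)%N by rewrite size_poly_gt0.
have leH i : pabs R P`_i <= q ^+ H.
  rewrite /pabs; case: eqP => [_|/eqP Pi]; first by rewrite exprn_ge0 // ltW // (lt_trans ltr01).
  have iP : (i < size P)%N by apply: contraNT Pi; rewrite -leqNgt => ?; rewrite nth_default.
  by rewrite ler_eXn2l // (leq_bigmax (Ordinal iP)).
have [j Pj jH] : exists2 j, P`_j != 0 & (size (P`_j)).-1 = H.
  have := @bigop.eq_bigmax _ (fun i : 'I_(size P) => (size (P`_i)%R).-1).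
  rewrite card_ord => /(_ s0)[j jE]; rewrite -/H in jE.
  (* The zero polynomial counts as degree 0 here, so the maximum may be attained at a zero
     coefficient; then H = 0 and the leading coefficient of P serves instead. *)
  have [Pj0 | Pj] := eqVneq P`_j 0; last by exists j.
  exists (size P).-1; first by rewrite -lead_coefE lead_coef_eq0.
  have H0 : H = 0%N by rewrite jE Pj0 size_poly0.
  apply/eqP; rewrite H0 -leqn0 -[X in (_ <= X)%N]H0.
  have ls : ((size P).-1 < size P)%N by rewrite prednK.
  exact: (leq_bigmax (Ordinal ls)).
split=> //; last by exists j.
apply/le_anti; rewrite /height; apply/andP; split.
  by apply/bigmax_leP; split=> [|i _]; rewrite ?exprn_ge0 // ltW // (lt_trans ltr01).
have jP : (j < size P)%N by apply: contraNT Pj; rewrite -leqNgt => ?; rewrite nth_default.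
have := @le_bigmax _ _ _ 0 (fun i : 'I_(size P) => pabs R P`_i) (Ordinal jP).
by rewrite {1}/pabs /= (negPf Pj) jH.
Qed.

Lemma powR_expN (H E : nat) (w : R) :
  (q ^- E <= (q ^+ H) `^ (- w)) = (w * H%:R <= E%:R).
Proof.
have q1 : 1 < q := card_gt1 R F.
have q0 : 0 <= q := ltW (lt_trans ltr01 q1).
have -> : q ^- E = q `^ (- E%:R) by rewrite powRN powR_mulrn.
rewrite -(powR_mulrn H) // -powRrM mulrN mulrC.
apply/idP/idP => [|wE]; last by rewrite ler_powR ?(ltW q1) // lerN2.
apply: contraTT; rewrite -!ltNge => lt; rewrite /powR gt_eqF ?(lt_trans ltr01) //.
by rewrite ltr_expR ltr_pM2r ?ln_gt0 // ltrN2.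
Qed.

End ValuedRing.

(** * Size of the coefficients under substitution *)

Section UltrametricForms.
Variables (R : realType) (K : fieldType) (abs : K -> R).
Hypothesis abs_ge0 : forall a, 0 <= abs a.
Hypothesis abs0 : abs 0 = 0.
Hypothesis abs_eq0 : forall a, abs a = 0 -> a = 0.
Hypothesis absM : forall a b, abs (a * b) = abs a * abs b.
Hypothesis absD : forall a b, abs (a + b) <= Num.max (abs a) (abs b).

Lemma abs_two_mul a : abs (2 * a) <= abs a.
Proof. by rewrite absM ler_piMl // (abs_natr_le1 abs0 abs_eq0 absM absD). Qed.

Lemma abs_mul3_le x y z C D : abs x <= C -> abs y <= D -> abs z <= D ->
  abs (x * y * z) <= C * D ^+ 2.
Proof. by move=> xC yD zD; rewrite !absM expr2 mulrA !ler_pM ?mulr_ge0. Qed.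

Lemma abs_qsubst_le e b d f C D :
  abs e <= D -> abs b <= D -> abs d <= D ->
  abs f.1.1 <= C -> abs f.1.2 <= C -> abs f.2 <= C ->
  [/\ abs (qsubst e b d f).1.1 <= C * D ^+ 2, abs (qsubst e b d f).1.2 <= C * D ^+ 2 &
      abs (qsubst e b d f).2 <= C * D ^+ 2].
Proof.
case: f => [[u v] w] /= eD bD dD uC vC wC; set M := C * _.
have aD := absD_le absD; have aB := absB_le abs_ge0 abs_eq0 absM absD.
split.
- by rewrite !expr2 !mulrA; apply: (aD); [apply: (aB)|]; apply: abs_mul3_le.
- apply: (aB); last first.
    by rewrite -!mulrA; apply: le_trans (abs_two_mul _) _; rewrite mulrA; apply: abs_mul3_le.
  apply: (aD).
    rewrite (absN abs_ge0 abs_eq0 absM) -!mulrA; apply: le_trans (abs_two_mul _) _.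
    by rewrite mulrA; apply: abs_mul3_le.
  by rewrite mulrDr expr2 !mulrA; apply: (aD); apply: abs_mul3_le.
- by rewrite !expr2 !mulrA; apply: (aD); [apply: (aB)|]; apply: abs_mul3_le.
Qed.

Lemma abs_mul3_lt x y z U D : 0 < U -> abs x <= U -> abs y <= D -> abs z < D ->
  abs (x * y * z) < U * D ^+ 2.
Proof.
move=> U0 xU yD zD; have D0 : 0 < D by apply: le_lt_trans zD.
rewrite !absM expr2 mulrA; apply: (@le_lt_trans _ _ (U * D * abs z)).
  by rewrite ler_wpM2r // ler_pM.
by rewrite ltr_pM2l // mulr_gt0.
Qed.

(* The leading coefficient dominates the other two, i.e. both roots of the
   form are small, as soon as this holds before the substitution. *)
Lemma abs_qsubst_dominant e b d f :
  0 < abs f.1.1 -> abs e < abs d -> abs b < abs d ->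
  abs f.1.2 <= abs f.1.1 -> abs f.2 <= abs f.1.1 ->
  [/\ abs (qsubst e b d f).1.1 = abs f.1.1 * abs d ^+ 2,
      abs (qsubst e b d f).1.2 < abs f.1.1 * abs d ^+ 2 &
      abs (qsubst e b d f).2 < abs f.1.1 * abs d ^+ 2].
Proof.
case: f => [[u v] w] /= u0 ed bd vu wu; set M := abs u * _.
have aD := absD_lt absD; have aB := absB_lt abs_ge0 abs_eq0 absM absD.
have eD := ltW ed; have bD := ltW bd.
split.
- have -> : u * d ^+ 2 - v * b * d + w * b ^+ 2 = u * d ^+ 2 + (w * b ^+ 2 - v * b * d) by ring.
  have uM : abs (u * d ^+ 2) = M by rewrite absM (absX abs_eq0 absM).
  rewrite (absD_dominant abs_ge0 abs_eq0 absM absD) uM //.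
  apply: (aB); first by rewrite expr2 mulrA; apply: abs_mul3_lt.
  by rewrite mulrAC; apply: abs_mul3_lt.
- apply: (aB); last first.
    by rewrite -!mulrA; apply: le_lt_trans (abs_two_mul _) _; rewrite mulrA; apply: abs_mul3_lt.
  apply: (aD).
    rewrite (absN abs_ge0 abs_eq0 absM) -!mulrA; apply: le_lt_trans (abs_two_mul _) _.
    by rewrite mulrA mulrAC; apply: abs_mul3_lt.
  rewrite mulrDr expr2 !mulrA; apply: (aD); last exact: abs_mul3_lt.
  by rewrite mulrAC; apply: abs_mul3_lt.
- by rewrite !expr2 !mulrA; apply: (aD); [apply: (aB)|]; apply: abs_mul3_lt.
Qed.

(** The first step of the sequence: the twist of P_0 is dominated by its middle coefficient A^r, so
    the term v b d decides the size of the new leading coefficient. *)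
Lemma abs_qsubst_dominant_mid e b d f :
  0 < abs b -> abs e < abs b -> abs b < abs d ->
  abs d < abs f.1.2 * abs b -> abs f.1.1 <= 1 -> abs f.2 <= 1 ->
  [/\ abs (qsubst e b d f).1.1 = abs f.1.2 * abs b * abs d,
      abs (qsubst e b d f).1.2 < abs f.1.2 * abs b * abs d &
      abs (qsubst e b d f).2 < abs f.1.2 * abs b * abs d].
Proof.
case: f => [[u v] w] /= b0 eb bd dvb u1 w1; set M := abs v * abs b * _.
have aD := absD_lt absD; have aB := absB_lt abs_ge0 abs_eq0 absM absD.
have ed := lt_trans eb bd; have eD := ltW ed; have bD := ltW bd.
have d0 := lt_trans b0 bd.
have v0 : 0 < abs v by move: (lt_trans d0 dvb); rewrite pmulr_lgt0.
have unit_lt a y z : abs a <= 1 -> abs y <= abs d -> abs z <= abs d -> abs (a * y * z) < M.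
  move=> a1 yd zd; apply: le_lt_trans (abs_mul3_le a1 yd zd) _.
  by rewrite mul1r expr2 /M ltr_pM2r.
have v_lt y z : abs y <= abs b -> abs z < abs d -> abs (v * y * z) < M.
  move=> yb zd; rewrite !absM /M; apply: (@le_lt_trans _ _ (abs v * abs b * abs z)).
    by rewrite ler_wpM2r // ler_wpM2l.
  by rewrite ltr_pM2l // mulr_gt0.
have vM : abs (v * b * d) = M by rewrite !absM.
split.
- have -> : u * d ^+ 2 - v * b * d + w * b ^+ 2 = - (v * b * d - (u * d * d + w * b * b)) by ring.
  rewrite (absN abs_ge0 abs_eq0 absM) (absB_dominant abs_ge0 abs_eq0 absM absD) vM //.
  by apply: (aD); apply: (unit_lt).
- apply: (aB); last first.
    by rewrite -!mulrA; apply: le_lt_trans (abs_two_mul _) _; rewrite mulrA; apply: (unit_lt).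
  apply: (aD).
    rewrite (absN abs_ge0 abs_eq0 absM) -!mulrA; apply: le_lt_trans (abs_two_mul _) _.
    by rewrite mulrA; apply: (unit_lt).
  rewrite mulrDr expr2 !mulrA; apply: (aD); last exact: v_lt.
  rewrite !absM /M ltr_pM2r // ltr_pM2l //.
- rewrite !expr2 !mulrA; apply: (aD); last exact: unit_lt.
  by apply: (aB); [apply: (unit_lt) | apply: (v_lt)].
Qed.

(** Each x^i - a^i is x - a times a sum of products of absolute value at most 1. *)
Lemma abs_horner_diff_le (P : {poly K}) x a C : abs x <= 1 -> abs a <= 1 ->
  (forall i, abs P`_i <= C) -> abs (P.[x] - P.[a]) <= C * abs (x - a).
Proof.
move=> x1 a1 PC; have C0 : 0 <= C by apply: le_trans (PC 0).
rewrite !horner_coef -sumrB; apply: (abs_sum_le abs0 absD) => [|i _]; first exact: mulr_ge0.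
rewrite -mulrBr subrXX absM ler_pM // absM ler_piMr //.
apply: (abs_sum_le abs0 absD) => // j _.
by rewrite absM !(absX abs_eq0 absM) mulr_ile1 ?exprn_ge0 ?exprn_ile1.
Qed.

End UltrametricForms.

(** * Approximation of the fixed point *)

Section Approximation.
Variables (R : realType) (K : fieldType) (abs : K -> R) (F : finFieldType).
Variable phi : {rmorphism {poly F} -> K}.
Hypothesis abs_ge0 : forall a, 0 <= abs a.
Hypothesis abs_eq0 : forall a, abs a = 0 -> a = 0.
Hypothesis absM : forall a b, abs (a * b) = abs a * abs b.
Hypothesis absD : forall a b, abs (a + b) <= Num.max (abs a) (abs b).
Hypothesis abs_phi : forall a, abs (phi a) = pabs R a.

Variables (r l n : nat) (c : F) (e b d : {poly F}) (x : K).
Hypothesis r_pchar : [pchar F].-nat r.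
Hypothesis r_gt1 : (1 < r)%N.
Hypothesis FrF : forall x : F, x ^+ r = x.
Hypothesis l_gt0 : (0 < l)%N.
Hypothesis dE : d = e + b * ('X + c%:P).
Hypothesis det1 : (e * d - b ^+ 2) ^+ 2 = 1.
Hypothesis sd : size d = l.+1.
Hypothesis sb : size b = l.
Hypothesis se : (size e < l)%N.
Hypothesis anis : forall x y : F, x ^+ 2 + c * x * y - y ^+ 2 = 0 -> x = 0 /\ y = 0.
Hypothesis x_lt1 : abs x < 1.
Hypothesis x_root : phi b * x ^+ r.+1 - phi e * x ^+ r + phi d * x - phi b = 0.

Let q : R := #|F|%:R.
Let A : {poly F} := 'X + c%:P.

Lemma q_gt1 : 1 < q. Proof. exact: card_gt1. Qed.
Lemma q_gt0 : 0 < q. Proof. exact: lt_trans q_gt1. Qed.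
Lemma q_neq0 : q != 0. Proof. by rewrite gt_eqF ?q_gt0. Qed.
Lemma qX_gt0 k : 0 < q ^+ k. Proof. by rewrite exprn_gt0 ?q_gt0. Qed.

Lemma abs_zero : abs 0 = 0.
Proof. by rewrite -(rmorph0 phi) abs_phi /pabs eqxx. Qed.

Lemma abs_phi_size (a : {poly F}) k : size a = k.+1 -> abs (phi a) = q ^+ k.
Proof.
move=> sa; rewrite abs_phi /pabs sa ifF //.
by apply/negP => /eqP a0; move: sa; rewrite a0 size_poly0.
Qed.

Lemma abs_phi_ge1 (a : {poly F}) : a != 0 -> 1 <= abs (phi a).
Proof. by move=> a0; rewrite abs_phi /pabs (negPf a0) exprn_ege1 // ltW // q_gt1. Qed.

Lemma phi_inj : injective phi.
Proof.
apply: raddf_inj => a pa; apply/eqP; apply: contraT => a0.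
by have := abs_phi_ge1 a0; rewrite pa abs_zero ler10.
Qed.

Lemma abs_phi_det : abs (phi (e * d - b ^+ 2)) = 1.
Proof.
apply/eqP; rewrite -(@eqrXn2 _ 2) ?expr1n // -(absX abs_eq0 absM) -rmorphXn det1 rmorph1.
by rewrite (abs1 abs_eq0 absM).
Qed.

Lemma abs_d : abs (phi d) = q ^+ l.
Proof. exact: abs_phi_size. Qed.

Lemma abs_b : abs (phi b) = q ^+ l.-1.
Proof. by apply: abs_phi_size; rewrite sb prednK. Qed.

Lemma abs_A : abs (phi A) = q.
Proof. by rewrite (@abs_phi_size _ 1) ?expr1 // size_XaddC. Qed.

Lemma abs_e_lt : abs (phi e) < abs (phi b).
Proof.
rewrite abs_b abs_phi /pabs; case: eqP => [_|/eqP e0]; first exact: qX_gt0.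
rewrite ltr_eXn2l ?q_gt1 //; move: se; rewrite -(prednK l_gt0) ltnS; apply: leq_trans.
by rewrite prednK // size_poly_gt0.
Qed.

Lemma abs_b_lt : abs (phi b) < abs (phi d).
Proof. by rewrite abs_b abs_d ltr_eXn2l ?q_gt1 // prednK. Qed.

Lemma abs_xX k : abs (x ^+ k) <= 1.
Proof. by rewrite (absX abs_eq0 absM) exprn_ile1 // ltW. Qed.

Lemma abs_mul_xX_le a k : abs (a * x ^+ k) <= abs a.
Proof. by rewrite absM ler_piMr // abs_xX. Qed.

(** The value group of K may be larger than that of the Laurent series, so |x| <= 1/q is drawn from
    the equation: d x has the size of b at most. *)
Lemma abs_x_le : q * abs x <= 1.
Proof.
have xE : phi d * x = phi b - phi b * x ^+ r.+1 + phi e * x ^+ r.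
  by apply/eqP; rewrite -subr_eq0; apply/eqP; rewrite -[RHS]x_root; ring.
have : abs (phi d) * abs x <= abs (phi b).
  rewrite -absM xE; do ![apply: (absB_le abs_ge0 abs_eq0 absM absD) | apply: (absD_le absD)] => //.
    exact: abs_mul_xX_le.
  by apply: le_trans (abs_mul_xX_le _ _) (ltW abs_e_lt).
rewrite abs_d abs_b -(prednK l_gt0) exprS [q * _]mulrC -mulrA /= => h.
by rewrite -(ler_pM2l (qX_gt0 l.-1)) mulr1.
Qed.

Lemma abs_Axr_lt : abs (phi A * x ^+ r) < 1.
Proof.
rewrite absM abs_A (absX abs_eq0 absM) -(prednK (ltnW r_gt1)) exprS mulrA.
apply: le_lt_trans (_ : 1 * abs x ^+ r.-1 < 1); first by rewrite ler_wpM2r ?abs_x_le ?exprn_ge0.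
by rewrite mul1r exprn_ilt1 // -lt0n -ltnS prednK // ltnW.
Qed.

(** The factor in (d -b; -b e) (x, 1) = lam (x^r, 1), which restates the equation of x. *)
Definition lam : K := phi e - phi b * x.

Lemma lam_mul : lam * (phi b * x ^+ r + phi d) = phi (e * d - b ^+ 2).
Proof.
have bx : phi b * x ^+ r.+1 = phi e * x ^+ r - phi d * x + phi b.
  by apply/eqP; rewrite -subr_eq0; apply/eqP; rewrite -[RHS]x_root; ring.
rewrite /lam rmorphB !rmorphM /=.
transitivity (phi e * phi b * x ^+ r + phi e * phi d - phi b * (phi b * x ^+ r.+1) - phi b * phi d * x).
  by rewrite exprS; ring.
by rewrite bx; ring.
Qed.

Lemma abs_lam_denom : abs (phi b * x ^+ r + phi d) = q ^+ l.
Proof.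
rewrite addrC (absD_dominant abs_ge0 abs_eq0 absM absD) ?abs_d //.
by rewrite -abs_d (le_lt_trans (abs_mul_xX_le _ _)) // abs_b_lt.
Qed.

Lemma abs_lam : abs lam = q ^- l.
Proof.
have := congr1 abs lam_mul; rewrite absM abs_phi_det abs_lam_denom => h.
by apply: (mulIf (expf_neq0 l q_neq0)); rewrite h mulVf // expf_neq0 // q_neq0.
Qed.

Definition qphi (f : {poly F} * {poly F} * {poly F}) : K * K * K :=
  (phi f.1.1, phi f.1.2, phi f.2).

Lemma horner_qpoly f a : (map_poly phi (qpoly f)).[a] = qform (qphi f) a 1.
Proof.
have [C0 C1 C2 C3] := coef_qpoly f.
rewrite (@horner_coef_wide _ 3); last first.
  rewrite (leq_trans (size_poly _ _)) //; apply/leq_sizeP => j; exact: C3.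
rewrite 2!big_ord_recr big_ord1 /= !coef_map C0 C1 C2 /qform /=.
by ring.
Qed.

Lemma qphi_subst f : qphi (qsubst e b d f) = qsubst (phi e) (phi b) (phi d) (qphi f).
Proof.
rewrite /qphi /qsubst /=.
by congr ((_, _), _); ring.
Qed.

(** Exponents of q: [zseq k] belongs to 1 / |P_k(x)|, [hseq k] bounds the coefficients of P_k, and
    [tseq k] belongs to the leading coefficient of P_(k+1). *)
Notation zseq := (affine_iter r (2 * l) (2 * l)).
Notation hseq := (affine_iter r (2 * l) 1).
Notation tseq := (affine_iter r (2 * l) (r + (2 * l).-1)).
Notation qs := (qseq r c e b d).

(** As d = e + bA, the matrix (e b; b d) multiplies the form P_0 by its determinant. With y = x^r
    and w = by + d this gives P_0(x) w^2 = det P_0(y), where |P_0(y)| = 1 because y and Ay are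
    small. *)
Lemma abs_qseq_base : abs (qform (qphi (qs 0)) x 1) = q ^- (2 * l).
Proof.
pose y := x ^+ r; pose w := phi b * y + phi d.
have xw : x * w = phi e * y + phi b.
  apply/eqP; rewrite -subr_eq0; apply/eqP; rewrite -[RHS]x_root /w /y exprS; ring.
have E : qform (qphi (qs 0)) x 1 * w ^+ 2 = phi (e * d - b ^+ 2) * (y ^+ 2 + phi A * y - 1).
  have -> : qform (qphi (qs 0)) x 1 * w ^+ 2 = (x * w) ^+ 2 + phi A * (x * w) * w - w ^+ 2.
    by rewrite /qform /= -/A rmorph1 rmorphN1; ring.
  by rewrite xw /w dE -/A; ring.
have y1 : abs y < 1.
  by rewrite /y (absX abs_eq0 absM) exprn_ilt1 // -lt0n ltnW.
have E1 : abs (y ^+ 2 + phi A * y - 1) = 1.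
  rewrite addrC (absD_dominant abs_ge0 abs_eq0 absM absD) (absN abs_ge0 abs_eq0 absM) (abs1 abs_eq0 absM) //.
  apply: (absD_lt absD); last exact: abs_Axr_lt.
  by rewrite (absX abs_eq0 absM) exprn_ilt1.
have := congr1 abs E; rewrite (absM _ (w ^+ 2)) (absM (phi _)) abs_phi_det E1 mulr1 (absX abs_eq0 absM) abs_lam_denom.
rewrite -exprM mulnC => h; apply: (mulIf (expf_neq0 (2 * l) q_neq0)).
by rewrite h mulVf // expf_neq0 // q_neq0.
Qed.

Lemma qform_frob (f : {poly F} * {poly F} * {poly F}) :
  qform (qphi (qpow r f)) (x ^+ r) 1 = qform (qphi f) x 1 ^+ r.
Proof.
have rK : [pchar K].-nat r.
  by apply: sub_in_pnat r_pchar => p _; exact: (rmorph_pchar (phi \o polyC)).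
rewrite /qform /= !exprDn_pchar // !exprMn !rmorphXn !expr1n.
by rewrite -!exprM [(r * 2)%N]mulnC mul2n -addnn exprD !mulr1.
Qed.

Lemma abs_qseq k : abs (qform (qphi (qs k)) x 1) = q ^- zseq k.
Proof.
elim: k => [|k IH]; first exact: abs_qseq_base.
have E : phi d * x - phi b * 1 = lam * x ^+ r.
  by apply/eqP; rewrite -subr_eq0; apply/eqP; rewrite -[RHS]x_root /lam exprS; ring.
rewrite qseqS qphi_subst qform_subst E.
have -> : phi e * 1 - phi b * x = lam * 1 by rewrite /lam !mulr1.
have -> (f : K * K * K) : qform f (lam * x ^+ r) (lam * 1) = lam ^+ 2 * qform f (x ^+ r) 1.
  by rewrite /qform; ring.
rewrite qform_frob absM !(absX abs_eq0 absM) IH abs_lam /=.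
by rewrite exprD invfM -!exprVn -!exprM mulrC [(l * 2)%N]mulnC [(r * _)%N]mulnC.
Qed.

Lemma abs_qphi_qpow f :
  [/\ abs (qphi (qpow r f)).1.1 = abs (qphi f).1.1 ^+ r,
     abs (qphi (qpow r f)).1.2 = abs (qphi f).1.2 ^+ r &
     abs (qphi (qpow r f)).2 = abs (qphi f).2 ^+ r].
Proof. by split; rewrite /= rmorphXn (absX abs_eq0 absM). Qed.

Lemma abs_qseq_coef_le k : [/\ abs (qphi (qs k)).1.1 <= q ^+ hseq k,
  abs (qphi (qs k)).1.2 <= q ^+ hseq k & abs (qphi (qs k)).2 <= q ^+ hseq k].
Proof.
have q1 := ltW q_gt1; elim: k => [|k [IH2 IH1 IH0]].
  rewrite /= !expr1 rmorph1 rmorphN1 -/A abs_A (absN abs_ge0 abs_eq0 absM).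
  by rewrite (abs1 abs_eq0 absM).
rewrite qseqS qphi_subst; have -> : q ^+ hseq k.+1 = (q ^+ hseq k) ^+ r * (q ^+ l) ^+ 2.
  by rewrite -!exprM -exprD [(_ * r)%N]mulnC [(l * 2)%N]mulnC.
have [E2 E1 E0] := abs_qphi_qpow (qs k).
apply: (abs_qsubst_le abs_ge0 abs_zero abs_eq0 absM absD); rewrite ?E2 ?E1 ?E0 -?abs_d //.
- by rewrite ltW // (lt_trans abs_e_lt abs_b_lt).
- by rewrite ltW // abs_b_lt.
- by rewrite lerXn2r ?nnegrE // ltW // qX_gt0.
- by rewrite lerXn2r ?nnegrE // ltW // qX_gt0.
- by rewrite lerXn2r ?nnegrE // ltW // qX_gt0.
Qed.

(** In the twist of P_0 the middle coefficient dominates; from P_1 on the leading coefficient does,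
    and the substitution preserves this. *)
Lemma abs_qseq_lead k :
  [/\ abs (qphi (qs k.+1)).1.1 = q ^+ tseq k, abs (qphi (qs k.+1)).1.2 < q ^+ tseq k &
     abs (qphi (qs k.+1)).2 < q ^+ tseq k].
Proof.
elim: k => [|k [IH2 IH1 IH0]]; rewrite [qs _.+1]qseqS qphi_subst.
  have [E2 E1 E0] := abs_qphi_qpow (qs 0).
  have F2 : abs (qphi (qpow r (qs 0))).1.1 = 1.
    by rewrite E2 /= rmorph1 (abs1 abs_eq0 absM) expr1n.
  have F1 : abs (qphi (qpow r (qs 0))).1.2 = q ^+ r by rewrite E1 /= -/A abs_A.
  have F0 : abs (qphi (qpow r (qs 0))).2 = 1.
    by rewrite E0 /= rmorphN1 (absN abs_ge0 abs_eq0 absM) (abs1 abs_eq0 absM) expr1n.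
  have -> : q ^+ tseq 0 = abs (qphi (qpow r (qs 0))).1.2 * abs (phi b) * abs (phi d).
    by rewrite F1 abs_b abs_d -!exprD; congr (_ ^+ _) => /=; lia.
  apply: (abs_qsubst_dominant_mid abs_ge0 abs_zero abs_eq0 absM absD); rewrite ?F2 ?F0 //.
  - by rewrite abs_b qX_gt0.
  - exact: abs_e_lt.
  - exact: abs_b_lt.
  - by rewrite F1 abs_b abs_d -exprD ltr_eXn2l ?q_gt1 //; lia.
have [E2 E1 E0] := abs_qphi_qpow (qs k.+1); have -> : q ^+ tseq k.+1 = abs (qphi (qpow r (qs k.+1))).1.1 * abs (phi d) ^+ 2.
  by rewrite E2 IH2 abs_d -!exprM -exprD [(_ * r)%N]mulnC [(l * 2)%N]mulnC.
apply: (abs_qsubst_dominant abs_ge0 abs_zero abs_eq0 absM absD); rewrite ?E2 ?E1 ?E0 ?IH2.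
- by rewrite exprn_gt0 ?qX_gt0.
- exact: lt_trans abs_e_lt abs_b_lt.
- exact: abs_b_lt.
- by rewrite lerXn2r ?nnegrE // ltW // qX_gt0.
- by rewrite lerXn2r ?nnegrE // ltW // qX_gt0.
Qed.

Lemma abs_qseq_disc_le k : abs (qdisc (qphi (qs k))) <= q ^+ (2 * r ^ k).
Proof.
have -> : qdisc (qphi (qs k)) = phi (qdisc (qs k)) by rewrite /qdisc /=; ring.
rewrite (qseq_disc c r_pchar FrF det1) rmorphXn (absX abs_eq0 absM) exprM.
rewrite lerXn2r ?nnegrE ?(ltW (qX_gt0 _)) //.
have -> : phi (qdisc (1, 'X + c%:P, -1)) = phi A ^+ 2 + 4%:R by rewrite /qdisc /= -/A; ring.
apply: (absD_le absD); first by rewrite (absX abs_eq0 absM) abs_A.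
apply: le_trans (abs_natr_le1 abs_zero abs_eq0 absM absD _) _.
by rewrite exprn_ege1 // ltW ?q_gt1.
Qed.

(** Expand P_k at its root a: P_k(x) = (x - a) (P_k'(a) + u (x - a)). The square of P_k'(a) is the
    discriminant, so |P_k'(a)| is at most q^(r^k), and the closeness of a bounds the other term by
    1. *)
Lemma qseq_root_far k a : qform (qphi (qs k)) a 1 = 0 ->
  abs (qphi (qs k)).1.1 * abs (x - a) <= 1 -> q ^- (zseq k + r ^ k) <= abs (x - a).
Proof.
have := abs_qseq_disc_le k; have := abs_qseq k.
move: (qphi (qs k)) => [[u v] w]; rewrite /qform /qdisc /= => Px disc Pa close.
have PE : u * x ^+ 2 + v * x * 1 + w * 1 ^+ 2 = (x - a) * ((2 * u * a + v) + u * (x - a)).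
  by rewrite -[LHS]subr0 -[in LHS]Pa; ring.
have qr1 : 1 <= q ^+ (r ^ k) by rewrite exprn_ege1 // ltW ?q_gt1.
have lin : abs (2 * u * a + v) <= q ^+ (r ^ k).
  rewrite -(@ler_pXn2r _ 2) ?nnegrE // ?(ltW (qX_gt0 _)) //.
  rewrite -(absX abs_eq0 absM) -exprM [(r ^ k * 2)%N]mulnC.
  have -> : (2 * u * a + v) ^+ 2 =
      v ^+ 2 - 4 * u * w + 4 * u * (u * a ^+ 2 + v * a * 1 + w * 1 ^+ 2) by ring.
  by rewrite Pa mulr0 addr0.
have : q ^- zseq k <= abs (x - a) * q ^+ (r ^ k).
  rewrite -Px PE absM ler_wpM2l // (absD_le absD) //.
  by rewrite absM (le_trans close).
by rewrite exprD invfM ler_pdivrMr ?qX_gt0.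
Qed.

Lemma qseq_small k : abs (map_poly phi (qpoly (qs k))).[x] <=
  height R (qpoly (qs k)) `^ (- ((2 * l * r)%:R / (r.-1 + 2 * l)%:R)).
Proof.
have [C0 C1 C2 C3] := coef_qpoly (qs k).
have P0 : qpoly (qs k) != 0.
  by rewrite -size_poly_gt0 size_qpoly // (qseq_lead_neq0 FrF det1 anis).
have [H [-> _ [i Pi iH]]] := height_exp R P0.
rewrite horner_qpoly abs_qseq powR_expN.
have Hh : (H <= hseq k)%N.
  rewrite -(ler_eXn2l (x := q)) ?q_gt1 //.
  have -> : q ^+ H = abs (phi (qpoly (qs k))`_i) by rewrite abs_phi /pabs (negPf Pi) iH.
  have [h2 h1 h0] := abs_qseq_coef_le k.
  case: i {Pi iH} => [|[|[|i]]]; rewrite ?C0 ?C1 ?C2 //.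
  by rewrite C3 // rmorph0 abs_zero ltW // qX_gt0.
have s0 : (0 < r.-1 + 2 * l)%N by lia.
rewrite mulrAC ler_pdivrMr ?ltr0n // -!natrM ler_nat mulnC.
rewrite (leq_trans (_ : _ <= 2 * l * r * hseq k)%N) ?leq_mul2l ?Hh ?orbT //.
  by rewrite mulnC leq_mul2l Hh orbT.
by rewrite [X in (_ <= X)%N]mulnC (affine_iter_relation _ (ltnW r_gt1) l_gt0) leq_addr.
Qed.

Hypothesis n_gt0 : (0 < n)%N.
Hypothesis n_lt_r : (n < r)%N.
Hypothesis r_large : ((3 * n + 2) * r <= r * r + 2 * n)%N.
Hypothesis l_large : (r.-1 * r.-1 < 2 * l)%N.

(** A nonzero resultant lies in F[T] and has absolute value at least 1, so one of the two terms
    bounding it does too. The term with |P_k(x)| is excluded: its exponent is below (r - n) h + (n -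
    1) h = (r - 1) h <= z, where h = [hseq k] and z = [zseq k]. The term with |Q(x)| gives the
    claim. *)
Lemma coprime_qseq_far (Q : {poly {poly F}}) H k :
  (1 < size Q)%N -> ((size Q).-1 <= n)%N -> resultant (qpoly (qs k)) Q != 0 ->
  (forall i, abs (phi Q`_i) <= q ^+ H) -> (2 * H < (r - n) * hseq k)%N ->
  q ^- (n * hseq k + H) <= abs (map_poly phi Q).[x].
Proof.
move=> sQ Qn res0 QH Hh; set P := qpoly (qs k) in res0 *.
have u0 : (qs k).1.1 != 0 by apply: (qseq_lead_neq0 FrF det1 anis).
have sP : size P = 3%N by rewrite size_qpoly.
have [C0 C1 C2 C3] := coef_qpoly (qs k).
have size_phi T : size (map_poly phi T) = size T.
  by rewrite size_map_inj_poly ?rmorph0 //; exact: phi_inj.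
have phi_neq0 a : a != 0 -> phi a != 0.
  by move=> a0; rewrite -(rmorph0 phi) (inj_eq phi_inj).
have [h2 h1 h0] := abs_qseq_coef_le k.
have h_ge0 : 0 <= q ^+ hseq k := ltW (qX_gt0 _).
have PC i : abs (map_poly phi P)`_i <= q ^+ hseq k.
  rewrite coef_map /=; case: i => [|[|[|i]]].
  - by rewrite C0.
  - by rewrite C1.
  - by rewrite C2.
  - by rewrite C3 // rmorph0 abs_zero.
have QC i : abs (map_poly phi Q)`_i <= q ^+ H by rewrite coef_map; exact: QH.
have resE : phi (resultant P Q) = resultant (map_poly phi P) (map_poly phi Q).
  by apply: map_resultant; apply: phi_neq0; rewrite lead_coef_eq0 -size_poly_gt0 ?sP // ltnW.
have := abs_resultant_le abs_ge0 abs_zero abs_eq0 absM absD (ltW x_lt1) (qX_gt0 _) (qX_gt0 _) _ PC QC.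
rewrite !size_phi sP /= -resE horner_qpoly abs_qseq => /(_ _)/(le_trans (abs_phi_ge1 res0)).
rewrite addn2 => /(_ isT); rewrite le_max => /orP[]; last first.
  rewrite -exprM -[(q ^+ H) ^+ 1]/(q ^+ H) -exprD => le1.
  rewrite -div1r ler_pdivrMr ?qX_gt0 // mulrC (le_trans le1) // ler_wpM2r //.
  by rewrite ler_weXn2l ?(ltW q_gt1) // leq_add2r mulnC leq_mul2r Qn orbT.
rewrite -!exprM -exprD ler_pdivlMr ?qX_gt0 // mul1r ler_eXn2l ?q_gt1 // => bad.
exfalso; have gap := affine_iter_gap k (ltnW r_gt1) l_large.
move: bad; rewrite leqNgt => /negP[]; apply: leq_trans gap.
have [m mE] : exists m, ((size Q).-2 + m = n.-1)%N.
  exists (n.-1 - (size Q).-2)%N; apply: subnKC.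
  by rewrite -subn1 -[n.-1]subn1 leq_sub2r.
move: Hh mE; move: (_.-2) (affine_iter _ _ _ _) => s h Hh mE.
have rE : (r.-1 = (r - n) + s + m)%N by lia.
by rewrite rE; nia.
Qed.

(** Either Q is proportional to some P_k and the discriminant bound applies, or Q has nonzero
    resultant with every P_k. In the second case the least k with 2H < (r - n) [hseq k] is used;
    minimality keeps [hseq k] comparable to H. *)
Lemma root_distance (Q : {poly {poly F}}) H a : minpoly_shape Q ->
  ((size Q).-1 <= n)%N -> (map_poly phi Q).[a] = 0 ->
  (forall i, abs (phi Q`_i) <= q ^+ H) -> (exists i, abs (phi Q`_i) = q ^+ H) ->
  (r <= H)%N -> q ^+ H * abs (x - a) <= 1 ->
  q ^- (r * H + 2 * l * n) <= abs (x - a).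
Proof.
move=> mQ Qn Qa QH [j Qj] rH close.
have q1 := q_gt1.
have H_le1 : 1 <= q ^+ H by rewrite exprn_ege1 // ltW.
have xa1 : abs (x - a) <= 1.
  by apply: le_trans close; rewrite ler_peMl.
have a1 : abs a <= 1.
  rewrite (_ : a = x - (x - a)); last by ring.
  by apply: (absB_le abs_ge0 abs_eq0 absM absD) => //; exact: ltW.
have [[k res0] | nres] := pselect (exists k, resultant (qpoly (qs k)) Q = 0).
  have [v v0 QE] := qpoly_resultant0 FrF det1 anis mQ res0.
  have absv : abs (phi v%:P) = 1.
    by rewrite (@abs_phi_size _ 0) ?expr0 // size_polyC v0.
  have Qi i : abs (phi Q`_i) = abs (phi (qpoly (qs k))`_i).
    by rewrite QE coefZ rmorphM absM absv mul1r.
  have [C0 C1 C2 C3] := coef_qpoly (qs k).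
  have Pa : qform (qphi (qs k)) a 1 = 0.
    rewrite -horner_qpoly; move/eqP: Qa; rewrite QE linearZ_LR hornerZ mulf_eq0.
    by case/orP => [/eqP v00|/eqP //]; move: absv; rewrite v00 abs_zero => /eqP; rewrite eq_sym oner_eq0.
  (* P_0 has height q, which is excluded by r <= H. *)
  case: k {res0} Pa C0 C1 C2 C3 Qi QE => [|k] Pa C0 C1 C2 C3 Qi QE.
    have [h2 h1 h0] := abs_qseq_coef_le 0.
    have : q ^+ H <= q ^+ 1.
      rewrite -Qj Qi; case: j {Qj} => [|[|[|j]]]; rewrite ?C0 ?C1 ?C2 //.
      by rewrite C3 // rmorph0 abs_zero ltW // qX_gt0.
    by rewrite ler_eXn2l // => H1; exfalso; lia.
  have [lead _ _] := abs_qseq_lead k.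
  have tH : (tseq k <= H)%N.
    by rewrite -(ler_eXn2l (x := q)) // -lead -[(qphi _).1.1]/(phi (qs k.+1).1.1) -C2 -Qi QH.
  have far : q ^- (zseq k.+1 + r ^ k.+1) <= abs (x - a).
    apply: (qseq_root_far Pa); rewrite lead; apply: le_trans close.
    by rewrite ler_wpM2r // ler_weXn2l // ltW.
  apply: le_trans far; rewrite lef_pV2 ?posrE ?qX_gt0 // ler_weXn2l ?(ltW q1) //.
  apply: leq_trans (affine_iter_lead k r_gt1 l_gt0) _.
  by apply: leq_add; rewrite ?leq_pmulr // leq_mul2l tH orbT.
have ex_k : exists k, (2 * H < (r - n) * hseq k)%N.
  exists (2 * H).+1; have := @affine_iter_ge r (2 * l) 1 (2 * H).+1 r_gt1 _.
  by move=> /(_ _)h; apply: leq_trans (h _) _; [lia | rewrite leq_pmull //; lia].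
(* The least index is not 0, since [hseq 0] = 1 and 2H >= r - n; its predecessor violates the
   inequality and so bounds [hseq] from above. *)
case: (ex_minnP ex_k) => -[|k] hk mink.
  by exfalso; move: hk => /=; lia.
have hk' : ((r - n) * hseq k <= 2 * H)%N.
  by rewrite leqNgt; apply/negP => /mink; rewrite ltnn.
have res0 : resultant (qpoly (qs k.+1)) Q != 0 by apply/eqP => res0; apply: nres; exists k.+1.
have far := coprime_qseq_far mQ.1 Qn res0 QH hk.
have near : abs (map_poly phi Q).[x] <= q ^+ H * abs (x - a).
  rewrite -[X in abs X]subr0 -Qa.
  apply: (abs_horner_diff_le abs_ge0 abs_zero abs_eq0 absM absD) => //; first exact: ltW.
  by move=> i; rewrite coef_map; exact: QH.
have exps := affine_iter_height n_lt_r r_large hk'.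
have := le_trans far near; rewrite mulrC -ler_pdivrMr ?qX_gt0 // -invfM -exprD.
apply: le_trans; rewrite lef_pV2 ?posrE ?qX_gt0 // ler_weXn2l ?(ltW q1) //.
apply: (@leq_trans ((r - 2) * H + 2 * l * n + H + H)); first by rewrite !leq_add2r.
have -> : (r * H = (r - 2) * H + H + H)%N by rewrite -addnA addnn -mul2n -mulnDl subnK.
lia.
Qed.

(** If the height is q^H with H >= r, comparing the approximation with [root_distance] gives (w + 1)
    H <= rH + 2ln, that is H <= B. The cases H < r are absorbed by the summand r in the bound. *)
Lemma close_root_bounded (w : R) : r.-1%:R < w ->
  exists C, forall (Q : {poly {poly F}}) a, minpoly_shape Q -> ((size Q).-1 <= n)%N ->
    (map_poly phi Q).[a] = 0 -> abs (x - a) <= height R Q `^ (- w - 1) ->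
    forall i, (size (Q`_i)%R <= C)%N.
Proof.
move=> wr; pose B := (2 * l * n)%:R / (w - r.-1%:R).
have dw : 0 < w - r.-1%:R by rewrite subr_gt0.
have B0 : 0 <= B by rewrite divr_ge0 // ltW.
exists (r + Num.bound B).+1 => Q a mQ Qn Qa close i.
have Q0 : Q != 0 by rewrite -size_poly_gt0 ltnW ?mQ.1.
have [H [hE QH [j Qj jH]]] := height_exp R Q0.
have HC : (H <= r + Num.bound B)%N.
  have [Hr|rH] := ltnP H r; first by rewrite (leq_trans (ltnW Hr)) // leq_addr.
  rewrite hE in close.
  (* As w >= 0, the assumed closeness is at least that of 1 / H(Q), which [root_distance] asks
     for. *)
  have close1 : q ^+ H * abs (x - a) <= 1.
    rewrite -ler_pdivlMl ?qX_gt0 // mulr1 (le_trans close) //.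
    rewrite -powR_inv1 ?(ltW (qX_gt0 _)) // ler_powR ?exprn_ege1 ?(ltW q_gt1) //.
    by rewrite gerDr oppr_le0 (le_trans _ (ltW wr)).
  have far : q ^- (r * H + 2 * l * n) <= abs (x - a).
    apply: root_distance mQ Qn Qa _ _ rH close1 => [i0|]; rewrite ?abs_phi //.
    by exists j; rewrite abs_phi /pabs (negPf Qj) jH.
  have := le_trans far close; rewrite (_ : - w - 1 = - (w + 1)); last by ring.
  rewrite powR_expN => le1; rewrite (leq_trans _ (leq_addl _ _)) // ltnW //.
  rewrite -(ltr_nat R) (le_lt_trans _ (archi_boundP B0)) // ler_pdivlMr //.
  have rE : r%:R = r.-1%:R + 1 :> R by rewrite natr1 prednK // ltnW.
  by move: le1; rewrite natrD natrM rE; nra.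
have := QH i; rewrite /pabs; case: eqP => [->|_]; first by rewrite size_poly0.
rewrite ler_eXn2l ?q_gt1 // => iH; apply: leq_trans (leqSpred _) _.
by rewrite ltnS (leq_trans iH).
Qed.

End Approximation.

(** * The exponents *)

Lemma infinite_of_injective (T : Type) (S : set T) (f : nat -> T) :
  injective f -> (forall k, S (f k)) -> infinite_set S.
Proof.
move=> f_inj Sf fS; apply: infinite_nat.
apply: (sub_finite_set (B := (f @^-1` S)%classic)) => [k _|]; first exact: Sf.
by apply: finite_preimage fS => x y _ _; exact: f_inj.
Qed.

Lemma finite_bounded_polys (F : finFieldType) (n C : nat) :
  finite_set [set P : {poly {poly F}} |
    (size P <= n)%N /\ forall i, (size (P`_i)%R <= C)%N].
Proof.
(* The index types have one element more than required, so that they are inhabited and [inord] is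
   available even for n = 0 or C = 0. *)
pose f (g : {ffun 'I_n.+1 -> {ffun 'I_C.+1 -> F}}) : {poly {poly F}} :=
  \poly_(i < n) \poly_(j < C) g (inord i) (inord j).
apply: (sub_finite_set (B := [set` [seq f g | g : {ffun 'I_n.+1 -> {ffun 'I_C.+1 -> F}}]])).
  move=> P [Pn PC] /=; apply/fintype.imageP.
  exists [ffun i : 'I_n.+1 => [ffun j : 'I_C.+1 => P`_i`_j]] => //.
  apply/polyP => i; rewrite coef_poly; case: ltnP => ni; last first.
    by rewrite nth_default // (leq_trans Pn).
  apply/polyP => j; rewrite coef_poly; case: ltnP => Cj; last first.
    by rewrite nth_default // (leq_trans (PC i)).
  by rewrite !ffunE !inordK // ltnS ltnW.
exact: finite_seq.
Qed.

Lemma finite_roots (K : closedFieldType) (p : {poly K}) :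
  p != 0 -> finite_set [set a | p.[a] = 0].
Proof.
move=> p0; have [s pE] := closed_field_poly_normal p.
apply: (sub_finite_set (B := [set` s])); last exact: finite_seq.
move=> a /= pa; rewrite -root_prod_XsubC; move/eqP: pa.
by rewrite {1}pE hornerZ mulf_eq0 lead_coef_eq0 (negPf p0).
Qed.

(** * Transfer to the valued closure *)

Section ValuedClosure.
Variables (R : realType) (F : finFieldType) (K : closedFieldType).
Variables (absK : K -> R) (iota : laurent F -> K).
Hypothesis VC : valued_closure absK iota.

Lemma iota_lzero : iota (lzero F) = 0.
Proof.
have [_ a0 _ _ [_ _ _ _ ai]] := VC; apply: a0; rewrite ai.
by apply: labs_eq0 => m; exact: lcoef_lzero.
Qed.

Lemma lcoef_lpolyM (a b : {poly F}) m :
  lcoef (lpoly (a * b)) m = lcoef (lmul (lpoly a) (lpoly b)) m.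
Proof.
pose k := `|m|%N.
rewrite (@lcoef_lmul_lpoly _ _ _ _ (size a + k.+1)) ?leq_addr // lcoef_lpoly.
have [m0 | m0] := boolP (m <= 0); last first.
  by rewrite big1 // => j _; rewrite lcoef_lpoly ifF ?mulr0 //; lia.
have mE : m = - k%:Z by rewrite /k; lia.
rewrite -/k coefM (big_ord_widen (size a + k.+1) (fun j => a`_j * b`_(k - j))) ?leq_addl //.
rewrite big_mkcond; apply: eq_bigr => j _; rewrite lcoef_lpoly mE ltnS.
have -> : (- k%:Z + j%:Z <= 0) = (j <= k)%N by lia.
by case: ifP => jk; rewrite ?mulr0 //; congr (_ * b`_ _); lia.
Qed.

Lemma iota_lpoly_morphism : exists phi : {rmorphism {poly F} -> K},
  forall a, phi a = iota (lpoly a).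
Proof.
have [_ _ _ _ [ext iD iM i1 _]] := VC.
pose f a := iota (lpoly a : laurent F).
have fD a b : f (a + b) = f a + f b.
  rewrite /f -iD; apply: ext => m; rewrite lcoef_ladd !lcoef_lpoly coefD.
  by case: ifP; rewrite ?addr0.
have fB : zmod_morphism f by move=> a b; rewrite -[in RHS](subrK b a) (fD (a - b)) addrK.
have fM : monoid_morphism f.
  split=> [|a b]; last by rewrite /f -iM; apply: ext => m; exact: lcoef_lpolyM.
  rewrite /f -i1; apply: ext => m; rewrite lcoef_lpoly coefC /lcoef /= subr0.
  have [m0|m0|->] := ltgtP m 0 => //=.
  - by rewrite ifF //; apply/eqP; lia.
  - by rewrite ifF //; apply/eqP; lia.
pose phi : {rmorphism {poly F} -> K} := HB.pack f
  (GRing.isZmodMorphism.Build _ _ f fB) (GRing.isMonoidMorphism.Build _ _ f fM).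
by exists phi.
Qed.

Lemma evalK_horner (phi : {rmorphism {poly F} -> K}) P a :
  (forall a, phi a = iota (lpoly a)) -> evalK iota P a = (map_poly phi P).[a].
Proof.
move=> phiE; rewrite /evalK (@horner_coef_wide _ (size P)) ?size_poly //.
by apply: eq_bigr => i _; rewrite coef_map /= phiE.
Qed.

Lemma iota_leval P y : iota (leval P y) = evalK iota P (iota y).
Proof.
have [_ _ _ _ [ext iD iM i1 _]] := VC.
rewrite /leval (big_morph iota iD iota_lzero); apply: eq_bigr => i _.
rewrite iM; congr (_ * _); elim: (i : nat) => [|j IH]; first by rewrite i1 expr0.
by rewrite /= iM IH exprSr.
Qed.

End ValuedClosure.

(** The bound is the larger root of X^2 - (3n + 2) X + 2n, whose discriminant is 9n^2 + 4n + 4.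
    Moreover 2r >= 3n + 2 gives r > n. *)
Lemma sqrt_bound_nat (R : realType) (n r : nat) :
  ((3 * n + 2)%:R + Num.sqrt ((9 * n ^ 2 + 4 * n + 4)%:R)) / 2 <= r%:R :> R ->
  (n < r)%N /\ ((3 * n + 2) * r <= r * r + 2 * n)%N.
Proof.
rewrite ler_pdivrMr ?ltr0n // => le1.
set D : R := (9 * n ^ 2 + 4 * n + 4)%:R in le1 *.
have sqrD : Num.sqrt D ^+ 2 = D by rewrite sqr_sqrtr ?ler0n.
have s0 : 0 <= Num.sqrt D := sqrtr_ge0 D.
have le2 : (3 * n + 2 <= r * 2)%N.
  by rewrite -(ler_nat R) natrM; lra.
split; first by lia.
have : D <= ((r * 2 - (3 * n + 2)) ^ 2)%:R.
  rewrite -sqrD natrX natrB // natrM lerXn2r ?nnegrE //; last by lra.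
  by move: le1; rewrite -natrM -(ler_nat R) in le2 *; lra.
rewrite ler_nat => le3.
by have [j rE] : exists j, (r * 2 = 3 * n + 2 + j)%N; [exists (r * 2 - (3 * n + 2))%N; lia | nia].
Qed.

Theorem theorem1p2 (R : realType) (p n s t : nat) (F : finFieldType) :
  prime p -> (2 <= n)%N -> (1 <= s)%N -> (1 <= t)%N ->
  #|F| = (p ^ s)%N ->
  ((3 * n + 2)%:R + Num.sqrt ((9 * n ^ 2 + 4 * n + 4)%:R)) / 2
    <= ((p ^ s) ^ t)%:R :> R ->
  (4 <= p ^ s)%N ->
  exists alpha : laurent F,
    (exists P, is_minpolyL P alpha /\ degX P = ((p ^ s) ^ t).+1) /\
    forall (K : closedFieldType) (absK : K -> R) (iota : laurent F -> K),
      valued_closure absK iota ->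
      wn R n alpha <> wn_star absK iota n alpha.
Proof.
move=> p_pr n2 _ _ cardF /sqrt_bound_nat; set r := ((p ^ s) ^ t)%N.
move=> [n_lt_r r_large] _.
have pF : p \in [pchar F] by apply: card_finPcharP cardF p_pr.
have r_pchar : [pchar F].-nat r by rewrite !pnatX pnatE // pF.
have FrF (z : F) : z ^+ r = z.
  rewrite /r -cardF; elim: (t) => [|t' IH]; first by rewrite expn0 expr1.
  by rewrite expnSr exprM IH expf_card.
have r_gt1 : (1 < r)%N by apply: leq_ltn_trans n_lt_r; apply: ltnW.
have [c anis] := exists_anisotropic F.
pose A : {poly F} := 'X + c%:P.
have cassini k : (fib A k * fib A k.+2 - fib A k.+1 ^+ 2) ^+ 2 = 1.
  by rewrite fib_cassini -exprM mulnC exprM sqrrN expr1n expr1n.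
(* Two consecutive continuants cannot both vanish at T = 0, because of the determinant identity; so
   one of two consecutive exponents works. The size of l makes (r - 1)^2 < 2 (l + 1). *)
have [l l_gt bl0] : exists2 l, (r * r <= l)%N & (fib A l.+1).[0] != 0.
  have [b0|] := eqVneq (fib A (r * r).+1).[0] 0; last by exists (r * r)%N.
  exists (r * r).+1 => //; apply: contraTneq isT => b1.
  have := congr1 (fun a => a.[0]) (cassini (r * r)%N).
  rewrite horner_exp hornerD hornerN hornerM horner_exp b0 b1 mulr0 expr0n subr0 expr0n hornerC.
  by move/eqP; rewrite eq_sym oner_eq0.
pose e : {poly F} := fib A l; pose b : {poly F} := fib A l.+1; pose d : {poly F} := fib A l.+2.
have [se mb] := size_fib c l; have [sb md] := size_fib c l.+1.
have [sd _] := size_fib c l.+2.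
have dE : d = e + b * A by [].
have det1 : (e * d - b ^+ 2) ^+ 2 = 1 by exact: cassini.
have se1 : (size e < l.+1)%N by rewrite se.
pose N := hyperquad r e b d.
have [N1 N2 N3 N4] : [/\ N`_r.+1 = b, N`_r = - e, N`_1 = d & N`_0 = - b].
  by apply: coef_hyperquad_cases.
have sN : size N = r.+2 by rewrite size_hyperquad // monic_neq0.
(* The coefficient d of X is monic of degree l + 1, and all other coefficients have degree at most
   l. *)
have [||||alpha [alpha1 alpha_root]] := @laurent_root F N l.+1.
- by rewrite sN.
- by rewrite N3.
- by rewrite N3.
- move=> i i1; have [->|ir1] := eqVneq i r.+1; first by rewrite N1 sb.
  have [->|ir] := eqVneq i r; first by rewrite N2 size_polyN ltnW.
  have [->|i0] := eqVneq i 0%N; first by rewrite N4 size_polyN sb.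
  rewrite coef_hyperquad (negPf i1) (negPf ir1) (negPf ir) (negPf i0).
  by rewrite !mulr0n !subr0 addr0 size_poly0.
have mN : minpoly_shape N by apply: (minpoly_shape_hyperquad r_gt1 FrF _ dE det1 sd sb se1 md mb bl0 anis).
exists alpha; split; first by exists N; split; rewrite /degX ?sN.
move=> K absK iota VC wE.
have [a0 aeq0 aM aD [ext iD iM i1 ai]] := VC.
have [phi phiE] := iota_lpoly_morphism VC.
have abs_phi a : absK (phi a) = pabs R a by rewrite phiE ai labs_lpoly.
set x := iota alpha.
have x_lt1 : absK x < 1 by rewrite ai labs_lt1 // alpha1.
have evalE P y := evalK_horner P y phiE.
have x_root : phi b * x ^+ r.+1 - phi e * x ^+ r + phi d * x - phi b = 0.
  rewrite -horner_hyperquad -/N -evalE -(iota_leval VC) -(iota_lzero VC).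
  by apply: ext => m; rewrite alpha_root lcoef_lzero.
have l_large : (r.-1 * r.-1 < 2 * l.+1)%N by nia.
have l0 : (0 < l.+1)%N by [].
have n_gt0 : (0 < n)%N by exact: ltnW.
(* The limit of [zseq] / [hseq], with l + 1 in place of l; it exceeds r - 1 precisely because (r -
   1)^2 < 2 (l + 1). *)
pose w0 : R := (2 * l.+1 * r)%:R / (r.-1 + 2 * l.+1)%:R.
have w0r : r.-1%:R < w0.
  rewrite ltr_pdivlMr ?ltr0n; last by lia.
  by rewrite -natrM ltr_nat; nia.
have le1 : (w0%:E <= wn R n alpha)%E.
  apply: ereal_sup_ubound; exists w0 => //=.
  pose f k := qpoly (qseq r c e b d k).
  have fx k : absK (map_poly phi (f k)).[x] = #|F|%:R ^- affine_iter r (2 * l.+1) (2 * l.+1) k.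
    by rewrite horner_qpoly; apply: abs_qseq.
  (* The P_k are pairwise distinct since their values at x have distinct absolute values. *)
  apply: (@infinite_of_injective _ _ f) => [k k' fkk'|k].
    have q1 := card_gt1 R F.
    have := fx k; rewrite fkk' fx => /invr_inj/(ieexprIn (lt_trans ltr01 q1) (negbT (gt_eqF q1))).
    by move/(affine_iter_inj r_gt1 (isT : 0 < 2 * l.+1)%N).
  have sf : size (f k) = 3%N by rewrite size_qpoly // (qseq_lead_neq0 FrF det1 anis).
  split; first by rewrite /degX sf.
  rewrite -ai (iota_leval VC) evalE; split; last first.
    exact: (qseq_small a0 aeq0 aM aD abs_phi r_pchar r_gt1 FrF l0 dE det1 sd sb se1
      anis x_lt1 x_root).
  by rewrite fx invr_gt0 exprn_gt0 // (lt_trans ltr01 (card_gt1 R F)).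
have le2 : (wn_star absK iota n alpha <= (r.-1%:R)%:E)%E.
  apply: ge_ereal_sup => _ [w winf <-]; rewrite lee_fin leNgt; apply/negP => rw.
  have [C HC] : exists C, forall (Q : {poly {poly F}}) a, minpoly_shape Q -> ((size Q).-1 <= n)%N ->
    (map_poly phi Q).[a] = 0 -> absK (x - a) <= height R Q `^ (- w - 1) ->
    forall i, (size (Q`_i)%R <= C)%N.
    exact: (close_root_bounded a0 aeq0 aM aD abs_phi r_pchar r_gt1 FrF l0 dE det1 sd sb se1
      anis x_lt1 x_root n_gt0 n_lt_r r_large l_large rw).
  apply: winf.
  pose S := [set P : {poly {poly F}} | (size P <= n.+1)%N /\ forall i, (size (P`_i)%R <= C)%N]%classic.
  (* For w > r - 1 the minimal polynomials of the approximations have bounded degree and bounded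
     coefficients; there are finitely many of them, each with finitely many roots. *)
  apply: (sub_finite_set (B := (\bigcup_(P in S `&` [set P | P != 0]) [set a : K | (map_poly phi P).[a] = 0])%classic)).
    move=> a [P [[mP Pa] [Pn [_ Px]]]]; rewrite evalE in Pa.
    have P0 : P != 0 by rewrite -size_poly_gt0 ltnW ?mP.1.
    exists P => //; split=> //; split; first by rewrite (leq_trans (leqSpred _)).
    by apply: HC mP _ Pa Px.
  apply: bigcup_finite => [|P [_ /= P0]].
    by apply: sub_finite_set (finite_bounded_polys F n.+1 C) => P [].
  apply: finite_roots; rewrite map_poly_eq0_id0 //.
  by rewrite -(rmorph0 phi) (inj_eq (phi_inj abs_phi)) lead_coef_eq0.
by rewrite wE in le1; have := le_trans le1 le2; rewrite lee_fin leNgt w0r.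
Qed.
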